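(* For every integer $m\geq 2$, $$\int_0^1 \zeta_1(m,x)^2\,dx=\frac{1}{2m-1}+\frac{2(-1)^m}{\Gamma(m)^2}\Bigl\{\Gamma(2m-1)\,Z(m)-\sum_{n=m-1}^\infty \frac{(n+m-1)!}{(n-m+1)!}\,\psi(n+2-m)\,\{\zeta(n+m)-1\}\Bigr\}$$ $$\qquad+\frac{2}{\Gamma(m)^2}\sum_{n=0}^{m-2}(-1)^n\,(n+m-1)!\,(m-n-2)!\,\{\zeta(n+m)-1\},$$ where $Z(m):=\psi(2m-1)\,\zeta(2m-1)+\zeta'(2m-1)$.
   Context: For $\Re(a)>1$ and $x\in[0,1]$, the auxiliary Hurwitz zeta function is $\zeta_1(a,x)=\sum_{k=1}^\infty (k+x)^{-a}=\zeta(a,x+1)$; for $x\in(0,1]$ it equals $\zeta(a,x)-x^{-a}$, where $\zeta(a,x)$ is the Hurwitz zeta function. $\zeta(s)$ is the Riemann zeta function, $\zeta'$ its derivative, and $\psi=\Gamma'/\Gamma$ is the digamma function. *)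

(* Defs.v *)
From HB Require Import structures.
From mathcomp Require Import all_boot all_order all_algebra.
From mathcomp Require Import all_classical all_reals all_analysis.

Set Implicit Arguments.
Unset Strict Implicit.
Unset Printing Implicit Defensive.

Import Order.TTheory GRing.Theory Num.Theory.
Import numFieldNormedType.Exports.

Local Open Scope classical_set_scope.
Local Open Scope ring_scope.

(* The functions below are the restrictions of the classical functions to the
   real half-lines where the series and the integral converge. Outside of them
   the values of [limn] and [Rintegral] carry no meaning. *)

(* a > 1, 0 <= x <= 1 *)
Definition zeta1 (R : realType) (a x : R) : R :=
  \big[+%R/0]_(1 <= k <oo) (k%:R + x) `^ (- a).

(* s > 1 *)
Definition riemann_zeta (R : realType) (s : R) : R :=
  \big[+%R/0]_(1 <= k <oo) k%:R `^ (- s).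

(* x > 0 *)
Definition Gamma (R : realType) (x : R) : R :=
  \int[lebesgue_measure]_(t in `]0, +oo[) (t `^ (x - 1) * expR (- t)).

(* x > 0 *)
Definition digamma (R : realType) (x : R) : R := derive1 (@Gamma R) x / Gamma x.

(* a > 1 *)
Definition Zfun (R : realType) (a : R) : R :=
  digamma (2 * a - 1) * riemann_zeta (2 * a - 1)
  + derive1 (@riemann_zeta R) (2 * a - 1).

(* The factorials are those of n + m - 1 and n - m + 1 over n >= m - 1; the
   latter is written n.+1 - m because truncated n - m is wrong at n = m - 1. *)
Definition psi_term (R : realType) (m n : nat) : R :=
  ((n + m - 1)`!)%N%:R / ((n.+1 - m)`!)%N%:R * digamma (n%:R + 2 - m%:R)
  * (riemann_zeta (n + m)%N%:R - 1).

(* Main.v *)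
(* Expand the square of the series and integrate termwise: the diagonal terms
   telescope to 1 / (2m - 1), and grouping the products of the k-th and
   (k + d)-th terms by the gap d leaves twice the sum over d >= 1 of
   I_d = \int_1^oo (u (u + d))^-m du. Integrating by parts m - 1 times turns I_d
   into the finite sum of the statement (the boundary terms at u = 1 are powers
   of 1 / (d + 1)) plus a multiple of J_d = \int_1^oo du / (u (u + d)^(2m - 1)).
   With H_j the harmonic numbers and s = 2m - 1,
     J_d = (ln d - H_(s-1)) d^-s + \sum_j C(j + s - 1, j) H_j (d + 1)^-(s + j),
   by induction on s from the logarithmic series. Summing over d and exchanging
   the two sums produces zeta'(s) and the series of the statement, since
   psi(j + 1) = psi(1) + H_j; the terms in psi(1) cancel because
   \sum_j C(j + s - 1, j) (d + 1)^-(s + j) = d^-s.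
   Explicit primitives ([itail]) stand for the integrals over [1, oo). *)

Require Import Defs.
From HB Require Import structures.
From mathcomp Require Import all_boot all_order all_algebra.
From mathcomp Require Import all_classical all_reals all_analysis.
From mathcomp Require Import measurable_realfun ring lra zify.

Set Implicit Arguments.
Unset Strict Implicit.
Unset Printing Implicit Defensive.

Import Order.TTheory GRing.Theory Num.Theory.
Import numFieldNormedType.Exports.

Local Open Scope classical_set_scope.
Local Open Scope ring_scope.

(** * Power series *)

Lemma is_derive1_exprn (R : realType) (n : nat) (t : R) :
  is_derive t 1 (fun u : R => u ^+ n.+1) (n.+1%:R * t ^+ n).
Proof.
have h := @is_deriveX R R (@id R) n.+1 t 1 1 (is_derive_id t (1:R)).
by rewrite exprfctE in h; apply: is_derive_eq h _; rewrite /GRing.scale/= mulr1.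
Qed.

Lemma is_derive1_scale (R : realType) (f : R -> R) (c t df : R) :
  is_derive t 1 f df -> is_derive t 1 (fun u => c * f u) (c * df).
Proof. by move=> h; have := @is_deriveZ R R R f c t 1 df h. Qed.

Lemma is_derive1_exprNn (R : realType) (n : nat) (d y : R) : y + d != 0 ->
  is_derive y 1 (fun u : R => (u + d) ^- n.+1) (- n.+1%:R * (y + d) ^- n.+2).
Proof.
move=> yd0.
have da : is_derive y (1:R) (fun u : R => u + d) 1 by exact: is_derive_shift.
have d1 : is_derive (y + d) (1:R) (fun u : R => u^-1) (- (y + d) ^- 2).
  apply: DeriveDef; first exact: derivableV.
  by rewrite deriveV// derive_id /GRing.scale/= mulr1.
have dv := @is_derive1_comp _ (fun u => u ^+ n.+1) (fun u : R => u^-1) (y + d)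
  _ _ (is_derive1_exprn _ _) d1.
have h := @is_derive1_comp _ (fun u : R => u^-1 ^+ n.+1) (fun u => u + d) y _ _
  dv da.
rewrite (_ : (fun u : R => _) = (fun u => (u + d)^-1 ^+ n.+1)); last first.
  by apply/funext => u; rewrite exprVn.
by apply: is_derive_eq h _; rewrite mulr1 -!exprVn !exprS; ring.
Qed.

(** Replacing coefficients by their partial sums divides the generating function by [1 - x]. This is
    the induction step in [q] of the two binomial series below. *)
Lemma cvg_series_abel (R : realType) (a b : R^nat) (x B : R) :
  0 <= x < 1 -> (forall n, 0 <= a n) ->
  a 0%N = b 0%N -> (forall n, a n.+1 = a n + b n.+1) ->
  series (fun n => b n * x ^+ n) @ \oo --> B ->
  series (fun n => a n * x ^+ n) @ \oo --> B / (1 - x).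
Proof.
move=> /andP[x0 x1] a0 ab0 abS cvb.
(* The partial sums on the left are nondecreasing, so that summation by parts
   yields their convergence, hence the vanishing of the boundary term. *)
have x1' : 0 < 1 - x by rewrite subr_gt0.
have abel N : (1 - x) * series (fun n => a n * x ^+ n) N.+1 =
    series (fun n => b n * x ^+ n) N.+1 - a N * x ^+ N.+1.
  elim: N => [|N IH].
    by rewrite !seriesSr /series/= !big_geq// ab0 !expr0 expr1; ring.
  by rewrite seriesSr mulrDr IH [in RHS]seriesSr abS !exprS; ring.
have ax0 n : 0 <= a n * x ^+ n by rewrite mulr_ge0 ?exprn_ge0.
have cva : cvgn (series (fun n => a n * x ^+ n)).
  apply: nondecreasing_is_cvgn; first exact: nondecreasing_series.
  have /cvg_seq_bounded[M [_ /(_ (`|M| + 1)) bM]] : cvgn (series (fun n =>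
      b n * x ^+ n)) by apply/cvg_ex; exists B.
  exists ((`|M| + 1) / (1 - x)) => _ [n _ <-].
  rewrite (@le_trans _ _ (series (fun n => a n * x ^+ n) n.+1))//.
    by rewrite seriesSr lerDl.
  rewrite ler_pdivlMr// mulrC abel lerBlDr.
  rewrite (le_trans (ler_norm _))// (le_trans (bM _ n.+1 _))//.
    by rewrite (le_lt_trans (ler_norm M))// ltrDl.
  by rewrite lerDl exprS mulrCA mulr_ge0.
have cv0 := cvg_series_cvg_0 cva.
suff cv : (fun n => (1 - x) * series (fun n => a n * x ^+ n) n.+1) @ \oo --> B.
  rewrite -cvg_shiftS/= mulrC.
  rewrite (_ : (fun n => _) = (fun n =>
      (1 - x)^-1 * ((1 - x) * series (fun n => a n * x ^+ n) n.+1))).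
    by apply: cvgMl_tmp.
  by apply/funext => n; rewrite mulrA mulVf ?mul1r// gt_eqF.
under eq_fun do rewrite abel.
rewrite -[B]subr0; apply: cvgB; first by rewrite (cvg_shiftS (series _)).
rewrite (_ : (fun n => _) = (fun n => x * (a n * x ^+ n))).
  by rewrite -(mulr0 x); apply: cvgMl_tmp.
by apply/funext => n; rewrite exprS mulrCA.
Qed.

(** One half of Tonelli: for finitely many columns the sum commutes with the limit over the rows,
    and every finite rectangle lies below the sum of the full rows. *)
Lemma series_interchange_le (R : realType) (a : nat -> nat -> R) (r c : R^nat)
    (L : R) (N : nat) :
  (forall i j, 0 <= a i j) -> (forall i, series (a i) @ \oo --> r i) ->
  series r @ \oo --> L -> (forall j, series (a ^~ j) @ \oo --> c j) ->
  series c N <= L.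
Proof.
move=> a0 cvr cvL cvc.
have r0 i : 0 <= r i.
  rewrite -(cvg_lim (@Rhausdorff R) (cvr i)); apply: limr_ge.
    by apply/cvg_ex; exists (r i).
  by apply: nearW => n; apply: sumr_ge0.
have cvN : (fun I => \sum_(0 <= j < N) series (a ^~ j) I) @ \oo --> series c N.
  by apply: cvg_big => [|j _]; [exact: add_continuous|exact: cvc].
rewrite -(cvg_lim (@Rhausdorff R) cvN); apply: limr_le.
  by apply/cvg_ex; eexists; exact: cvN.
apply: nearW => I.
rewrite /series/= exchange_big/=.
apply: (@le_trans _ _ (series r I)).
  apply: ler_sum => i _.
  rewrite -(cvg_lim (@Rhausdorff R) (cvr i)).
  apply: (@nondecreasing_cvgn_le _ (series (a i))).
    exact: nondecreasing_series.
  by apply/cvg_ex; exists (r i).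
rewrite -(cvg_lim (@Rhausdorff R) cvL).
apply: (@nondecreasing_cvgn_le _ (series r)).
  exact: nondecreasing_series.
by apply/cvg_ex; exists L.
Qed.

(** The previous bound makes the series of columns converge; applied once more with rows and columns
    exchanged, it gives the opposite inequality. *)
Lemma cvg_series_interchange (R : realType) (a : nat -> nat -> R) (r c : R^nat)
    (L : R) :
  (forall i j, 0 <= a i j) -> (forall i, series (a i) @ \oo --> r i) ->
  series r @ \oo --> L -> (forall j, series (a ^~ j) @ \oo --> c j) ->
  series c @ \oo --> L.
Proof.
move=> a0 cvr cvL cvc.
have c0 j : 0 <= c j.
  rewrite -(cvg_lim (@Rhausdorff R) (cvc j)); apply: limr_ge.
    by apply/cvg_ex; exists (c j).
  by apply: nearW => n; apply: sumr_ge0.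
have cL N := series_interchange_le N a0 cvr cvL cvc.
have cvs : cvgn (series c).
  apply: nondecreasing_is_cvgn; first exact: nondecreasing_series.
  by exists L => _ [n _ <-].
suff -> : L = limn (series c) by [].
apply/eqP; rewrite eq_le; apply/andP; split; last first.
  by apply: limr_le => //; apply: nearW.
rewrite -(cvg_lim (@Rhausdorff R) cvL); apply: limr_le.
  by apply/cvg_ex; exists L.
apply: nearW => N.
exact: (@series_interchange_le R (fun j i => a i j) c r _ N).
Qed.

Lemma cvg_series_ln (R : realType) (x : R) : 0 <= x < 1 ->
  series (fun n => x ^+ n.+1 / n.+1%:R) @ \oo --> - ln (1 - x).
Proof.
move=> /andP[]; rewrite le_eqVlt => /predU1P[<- _|x0 x1].
  rewrite subr0 ln1 oppr0 (_ : series _ = cst 0); first exact: cvg_cst.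
  apply/funext => n; rewrite /series/= big1// => i _.
  by rewrite exprS !mul0r.
(* [g N] is the remainder of the series. It vanishes at 0 and its derivative is the geometric
   remainder, so the mean value theorem bounds it by a multiple of [x ^+ N]. *)
pose g N (t : R) := - ln (1 - t) - \sum_(0 <= j < N) t ^+ j.+1 / j.+1%:R.
have dg (N : nat) (t : R) : t < 1 -> is_derive t 1 (g N) (t ^+ N / (1 - t)).
  move=> t1.
  have t1' : 0 < 1 - t by rewrite subr_gt0.
  have d1 : is_derive t (1:R) (fun t => - ln (1 - t)) (1 - t)^-1.
    have dl : is_derive (1 - t) (1:R) (@ln R) (1 - t)^-1
        by exact: is_derive1_ln.
    have di : is_derive t (1:R) (fun t => 1 - t) (- 1).
      by apply: is_derive_eq; ring.
    have := @is_derive1_comp _ (@ln R) (fun t => 1 - t) t _ _ dl di.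
    move=> /is_deriveN h; apply: is_derive_eq h _.
    by rewrite mulrN1 opprK.
  have d2 : is_derive t (1:R) (fun t => \sum_(0 <= j < N) t ^+ j.+1 / j.+1%:R)
      (\sum_(0 <= j < N) t ^+ j).
    elim: N => [|N IH].
      rewrite big_geq// (_ : (fun t => _) = cst 0); first exact: is_derive_cst.
      by apply/funext => u; rewrite big_geq.
    rewrite big_nat_recr//= (_ : (fun t => _) = (fun t =>
        \sum_(0 <= j < N) t ^+ j.+1 / j.+1%:R) + (fun t : R =>
            N.+1%:R^-1 * t ^+ N.+1)).
      apply: is_deriveD => //.
      apply: is_derive_eq (is_derive1_scale _ (is_derive1_exprn _ _)) _.
      by rewrite mulrA mulVf ?mul1r// pnatr_eq0.
    by apply/funext => u; rewrite big_nat_recr//= [_ / _]mulrC.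
  apply: is_derive_eq (is_deriveB d1 d2) _.
  suff -> : \sum_(0 <= j < N) t ^+ j = (1 - t ^+ N) / (1 - t).
    by field; rewrite gt_eqF.
  elim: N {g d2} => [|N IH]; first by rewrite big_geq// expr0 subrr mul0r.
  by rewrite big_nat_recr//= IH exprS; field; rewrite gt_eqF.
have bd N : 0 <= - ln (1 - x) - series (fun n => x ^+ n.+1 / n.+1%:R) N <=
    x / (1 - x) * x ^+ N.
  have [||c] := @MVT R (g N) (fun t => t ^+ N / (1 - t)) 0 x x0.
  - move=> t; rewrite in_itv/= => /andP[_ tx]; apply: dg.
    exact: lt_trans x1.
  - apply: derivable_within_continuous => t; rewrite in_itv/= => /andP[_ tx].
    have [] // := dg N t; exact: le_lt_trans x1.
  rewrite in_itv/= => /andP[c0 cx].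
  rewrite {2}/g subr0 subr0 ln1 oppr0 big1; last first.
    by move=> i _; rewrite exprS !mul0r.
  rewrite subr0 subr0 /g => ->.
  have c1 : c < 1 by exact: lt_trans x1.
  apply/andP; split.
    by rewrite !mulr_ge0 ?invr_ge0 ?exprn_ge0 ?subr_ge0 ?ltW.
  rewrite mulrC -!mulrA ler_pM2l// mulrC.
  apply: ler_pM.
  - by rewrite invr_ge0 subr_ge0 ltW.
  - by rewrite exprn_ge0 ?ltW.
  - by rewrite lef_pV2 ?posrE ?subr_gt0// lerD2l lerN2 ltW.
  - by rewrite lerXn2r ?nnegrE// ltW.
rewrite -[- ln _]subr0.
rewrite (_ : series _ = (fun N =>
    - ln (1 - x) - (- ln (1 - x) - series (fun n => x ^+ n.+1 / n.+1%:R) N))).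
  apply: cvgB; first exact: cvg_cst.
  apply: (@squeeze_cvgr _ _ _ _ (cst 0) (fun N => x / (1 - x) * x ^+ N)).
  - by apply: nearW => N; exact: bd.
  - exact: cvg_cst.
  rewrite -(mulr0 (x / (1 - x))); apply: cvgMl_tmp; apply: cvg_expr.
  by rewrite ger0_norm// ltW.
by apply/funext => N; rewrite subKr.
Qed.

Lemma cvg_series_delta0 (R : realType) (x : R) :
  series (fun n => (n == 0)%:R * x ^+ n) @ \oo --> (1 : R).
Proof.
rewrite -cvg_shiftS/= (_ : (fun n => _) = cst 1); first exact: cvg_cst.
apply/funext => n; rewrite /series/= big_nat_recl// expr0 mulr1 big1 ?addr0//.
by move=> i _; rewrite mul0r.
Qed.

(** By Pascal's rule the coefficients for [q.+1] are the partial sums of those for [q]; the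
    induction starts from the indicator of 0, whose partial sums are 1. *)
Lemma cvg_series_bin (R : realType) (x : R) (q : nat) : 0 <= x < 1 ->
  series (fun j => 'C((j + q)%N, q)%:R * x ^+ j) @ \oo --> (1 - x) ^- q.+1.
Proof.
move=> x01; elim: q => [|q IH].
  rewrite (_ : _ ^- 1 = 1 / (1 - x)); last by rewrite expr1 div1r.
  apply: (@cvg_series_abel R _ (fun n => (n == 0)%:R)) => //.
  - by move=> n; rewrite !bin0 addr0.
  - exact: cvg_series_delta0.
rewrite exprS invfM mulrC.
apply: cvg_series_abel IH => //.
- by rewrite !add0n !binn.
- by move=> n; rewrite addSn binS natrD addSnnS.
Qed.

(** * The tails of the integrals of [1 / (u^p (u + d)^q)] *)

(* [itail d p q y] is the integral of [u ^- p.+1 * (u + d) ^- q.+1] over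
   [u >= y]: both exponents are shifted by one. *)
Fixpoint itail1 (R : realType) (d : R) (q : nat) (y : R) : R :=
  if q is q'.+1 then (itail1 d q' y - (y + d) ^- q / q%:R) / d
  else (ln (y + d) - ln y) / d.

(** Integration by parts lowers the power of u and raises that of u + d. The base case [itail1]
    rests on the partial fractions 1 / (u (u + d)^(q+1)) = (1 / (u (u + d)^q) - 1 / (u + d)^(q+1)) /
    d. *)
Fixpoint itail (R : realType) (d : R) (p q : nat) (y : R) : R :=
  if p is p'.+1 then
    (y ^- p * (y + d) ^- q.+1 - q.+1%:R * itail d p' q.+1 y) / p%:R
  else itail1 d q y.

Lemma is_derive1_itail1 (R : realType) (d y : R) (q : nat) : 0 < d -> 0 < y ->
  is_derive y 1 (itail1 d q) (- (y^-1 * (y + d) ^- q.+1)).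
Proof.
move=> d0 y0; have yd0 : 0 < y + d by exact: addr_gt0.
elim: q => [|q IH].
  have h1 : is_derive y (1:R) (fun u : R => ln (u + d)) (y + d)^-1.
    have := @is_derive1_comp _ (@ln R) (fun u => u + d) y _ _
      (is_derive1_ln yd0) (is_derive_shift y 1 d).
    by rewrite mulr1.
  have h := is_derive1_scale d^-1 (is_deriveB h1 (is_derive1_ln y0)).
  rewrite (_ : itail1 d 0 = fun u => d^-1 * (ln (u + d) - ln u)); last first.
    by apply/funext => u; rewrite /= mulrC.
  apply: is_derive_eq h _.
  by rewrite expr1; field; rewrite !gt_eqF.
have h := is_derive1_scale d^-1
  (is_deriveB IH (is_derive1_scale q.+1%:R^-1 (is_derive1_exprNn q
      (lt0r_neq0 yd0)))).
rewrite (_ : itail1 d q.+1 = fun u =>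
    d^-1 * (itail1 d q u - q.+1%:R^-1 * (u + d) ^- q.+1)); last first.
  by apply/funext => u /=; rewrite mulrC [_ / q.+1%:R]mulrC.
apply: is_derive_eq h _.
rewrite mulrA mulrN mulVf ?pnatr_eq0// mulN1r !exprS.
by field; rewrite !gt_eqF ?exprn_gt0.
Qed.

Lemma is_derive1_itail (R : realType) (d y : R) (p q : nat) : 0 < d -> 0 < y ->
  is_derive y 1 (itail d p q) (- (y ^- p.+1 * (y + d) ^- q.+1)).
Proof.
move=> d0 y0; have yd0 : 0 < y + d by exact: addr_gt0.
elim: p q => [|p IH] q.
  by rewrite expr1; exact: is_derive1_itail1.
have h1 : is_derive y (1:R) (fun u => u ^- p.+1) (- p.+1%:R * y ^- p.+2).
  have := @is_derive1_exprNn R p 0 y; rewrite addr0 gt_eqF// => /(_ isT).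
  by under eq_fun do rewrite addr0.
have h2 := is_deriveM h1 (is_derive1_exprNn q (lt0r_neq0 yd0)).
have h := is_derive1_scale p.+1%:R^-1
  (is_deriveB h2 (is_derive1_scale q.+1%:R (IH q.+1))).
rewrite (_ : itail d p.+1 q = fun u =>
    p.+1%:R^-1 * (u ^- p.+1 * (u +
        d) ^- q.+1 - q.+1%:R * itail d p q.+1 u)); last first.
  by apply/funext => u /=; rewrite mulrC.
apply: is_derive_eq h _.
rewrite /GRing.scale/= !exprS.
field.
by rewrite !gt_eqF ?exprn_gt0// nat1r pnatr_eq0.
Qed.

Lemma cvg_exprNn_pinfty (R : realType) (d : R) (n : nat) :
  (x + d) ^- n.+1 @[x --> +oo] --> 0.
Proof.
have h : (x + d)^-1 @[x --> +oo] --> (0:R).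
  apply/gtr0_cvgV0; last exact: cvg_addrr.
  by near=> x; rewrite -ltrBlDr sub0r; near: x; apply: nbhs_pinfty_gt;
      rewrite num_real.
rewrite (_ : 0 = 0 ^+ n.+1 :> R); last by rewrite exprS mul0r.
under eq_fun do rewrite -exprVn.
elim: n => [|n IH]; first by under eq_fun do rewrite expr1.
rewrite exprS; under eq_fun do rewrite exprS.
exact: cvgM.
Unshelve. all: by end_near. Qed.

Lemma cvg_itail (R : realType) (d : R) (p q : nat) : 0 < d ->
  itail d p q x @[x --> +oo] --> 0.
Proof.
move=> d0; elim: p q => [|p IH] q /=; last first.
  rewrite -[0](mul0r (p.+1%:R^-1)); apply: cvgMr_tmp.
  rewrite -[X in _ --> X]subr0 -[X in X - _](mul0r (0:R)).
  rewrite -[X in _ - X](mulr0 q.+1%:R).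
  apply: cvgB; last by apply: cvgMl_tmp; exact: IH.
  apply: cvgM; last exact: cvg_exprNn_pinfty.
  have := @cvg_exprNn_pinfty R 0 p.
  by under eq_fun do rewrite addr0.
elim: q => [|q IHq] /=.
  (* Since ln (1 + d / x) <= d / x, the logarithmic case is at most 1 / x, written with [x + 0] to
     fit [cvg_exprNn_pinfty]. *)
  apply: (@squeeze_cvgr _ _ _ _ (cst 0) (fun x => (x + 0) ^- 1)).
  - near=> x.
    have x0 : 0 < x by near: x; apply: nbhs_pinfty_gt; rewrite num_real.
    rewrite -ln_div ?posrE ?addr_gt0// addr0 expr1 divr_ge0 ?(ltW d0)//=;
        last first.
      by rewrite ln_ge0// mulrDl divff ?gt_eqF// lerDl divr_ge0// ltW.
    rewrite ler_pdivrMr// mulrDl divff ?gt_eqF//.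
    apply: le_trans (le_ln1Dx _) _; last by rewrite mulrC.
    by rewrite (@lt_le_trans _ _ 0) ?ltrN10// divr_ge0// ltW.
  - exact: cvg_cst.
  - exact: cvg_exprNn_pinfty.
rewrite -[0](mul0r d^-1); apply: cvgMr_tmp.
rewrite -[X in _ --> X]subr0 -[X in _ - X](mul0r q.+1%:R^-1).
apply: cvgB => //; apply: cvgMr_tmp.
exact: cvg_exprNn_pinfty.
Unshelve. all: by end_near. Qed.

(** Gives [itail] the sign of the integral it stands for, from its derivative and its limit alone;
    the proof compares [f y] with later values by the mean value theorem. *)
Lemma nincr_cvg0_ge0 (R : realType) (f df : R -> R) (y : R) : 0 < y ->
  (forall x : R, 0 < x -> is_derive x 1 f (df x)) ->
  (forall x : R, 0 < x -> df x <= 0) ->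
  f x @[x --> +oo] --> 0 -> 0 <= f y.
Proof.
move=> y0 fdf df0 f0.
rewrite -(cvg_lim (@Rhausdorff R) f0); apply: limr_le.
  by apply/cvg_ex; exists 0.
near=> x.
have yx : y < x by near: x; apply: nbhs_pinfty_gt; rewrite num_real.
have [||c] := @MVT R f df y x yx.
- move=> t; rewrite in_itv/= => /andP[yt _]; apply: fdf.
  exact: lt_trans yt.
- apply: derivable_within_continuous => t; rewrite in_itv/= => /andP[yt _].
  by have [] := fdf t (lt_le_trans y0 yt).
rewrite in_itv/= => /andP[yc _] fE.
rewrite -subr_le0 fE mulr_le0_ge0 ?subr_ge0 ?(ltW yx)//.
exact/df0/(lt_trans y0).
Unshelve. all: by end_near. Qed.

Lemma itail_ge0 (R : realType) (d y : R) (p q : nat) : 0 < d -> 0 < y ->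
  0 <= itail d p q y.
Proof.
move=> d0 y0; apply: (nincr_cvg0_ge0 y0 _ _ (cvg_itail p q d0)).
  by move=> x x0; exact: is_derive1_itail.
by move=> x x0; rewrite oppr_le0 mulr_ge0 ?invr_ge0 ?exprn_ge0 ?addr_ge0 ?ltW.
Qed.

(** The term subtracted in the integration by parts is nonnegative, so the boundary term
    dominates. *)
Lemma itail_le (R : realType) (d y : R) (p q : nat) : 0 < d -> 0 < y ->
  itail d p.+1 q y <= y ^- p.+1 * (y + d) ^- q.+1.
Proof.
move=> d0 y0.
have Y0 : 0 <= y ^- p.+1 * (y + d) ^- q.+1.
  by rewrite mulr_ge0 ?invr_ge0 ?exprn_ge0 ?addr_ge0 ?ltW.
rewrite /= ler_pdivrMr// (@le_trans _ _ (y ^- p.+1 * (y + d) ^- q.+1))//.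
  by rewrite gerBl mulr_ge0// itail_ge0.
by rewrite ler_peMr// ler1n.
Qed.

(** Unrolls the [p] integrations by parts; the two factorials clear all denominators. For [q = p]
    and [y = 1] it expresses I_d through J_d, which is [itail1 d (p + q) 1]. *)
Lemma fact_itail (R : realType) (d y : R) (p q : nat) :
  p`!%:R * q`!%:R * itail d p q y =
  \sum_(0 <= n < p) (-1) ^+ n * ((n + q)`!)%N%:R * ((p - n.+1)`!)%N%:R
     * (y ^- (p - n) * (y + d) ^- (n + q).+1)
  + (-1) ^+ p * ((p + q)`!)%N%:R * itail1 d (p + q) y.
Proof.
elim: p q => [|p IH] q.
  by rewrite big_geq// add0n add0r expr0 fact0 !mul1r.
rewrite big_nat_recl// expr0 mul1r add0n subn0 subn1/=.
have -> : p.+1`!%:R * q`!%:R * ((y ^- p.+1 * (y + d) ^- q.+1 -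
    q.+1%:R * itail d p q.+1 y) / p.+1%:R) =
  q`!%:R * p`!%:R * (y ^- p.+1 * (y + d) ^- q.+1) -
    p`!%:R * q.+1`!%:R * itail d p q.+1 y :> R.
  move: (y ^- p.+1 * _) => A; rewrite !factS !natrM; field.
  by rewrite nat1r pnatr_eq0.
rewrite IH opprD addrA; congr (_ + _ + _).
  rewrite -sumrN; apply: eq_bigr => i _.
  by rewrite addnS addSn subSS [(-1) ^+ _.+1]exprS mulN1r !mulNr.
by rewrite addnS addSn [(-1) ^+ _.+1]exprS mulN1r !mulNr.
Qed.

(** The formula for J_d of the overview with s = [q.+1], solved for its series and multiplied by (1
    + d)^s so that it becomes a power series in 1 / (1 + d). *)
Lemma cvg_series_bin_harmonic (R : realType) (d : R) (q : nat) : 0 < d ->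
  series (fun j => 'C((j + q)%N, q)%:R * series harmonic j * (1 +
      d)^-1 ^+ j) @ \oo -->
  (1 + d) ^+ q.+1 * (itail1 d q 1 - (ln d - series harmonic q) * d ^- q.+1).
Proof.
move=> d0; set x := (1 + d)^-1.
have d10 : 0 < 1 + d by rewrite addr_gt0.
have x01 : 0 <= x < 1 by rewrite invr_ge0 ltW//= invf_lt1// ltrDl.
have x1 : 1 - x = d / (1 + d) by rewrite /x; field; rewrite gt_eqF.
have H0 n : 0 <= series (@harmonic R) n
    by apply: sumr_ge0 => i _; exact: harmonic_ge0.
elim: q => [|q IH].
  rewrite [X in _ --> X](_ : _ = - ln (1 - x) / (1 - x)); last first.
    rewrite x1 /= ln1 ln_div ?posrE// /series/= big_geq//.
    by rewrite !expr1; field; rewrite !gt_eqF.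
  (* The harmonic numbers are the partial sums of [j%:R^-1], whose term at [j = 0] is 0 because the
     inverse of 0 is 0. *)
  apply: (@cvg_series_abel R _ (fun j => j%:R^-1)) => //.
  - by move=> n; rewrite mulr_ge0.
  - by rewrite /series/= big_geq// mulr0 invr0.
  - by move=> n; rewrite !bin0 !mul1r seriesSr.
  rewrite -cvg_shiftS [X in X @ _](_ : _ = series (fun n =>
      x ^+ n.+1 / n.+1%:R)).
    exact: cvg_series_ln.
  apply/funext => N; rewrite /= {1}/series/= big_nat_recl// invr0 mul0r add0r.
  by apply: eq_bigr => i _; rewrite mulrC.
rewrite [X in _ --> X](_ : _ = ((1 + d) ^+ q.+1 *
    (itail1 d q 1 - (ln d - series harmonic q) / d ^+ q.+1) +
    q.+1%:R^-1 * ((1 - x) ^- q.+1 - 1)) / (1 - x)); last first.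
  rewrite x1 /= seriesSr/= expr_div_n !exprS.
  field.
  by rewrite !gt_eqF ?exprn_gt0// nat1r pnatr_eq0.
(* Differences of C(j + q + 1, q + 1) H_j: Pascal's rule gives the first summand, and C(j + q, q +
   1) / j = C(j + q, q) / (q + 1) the second for j > 0. The indicator of 0 corrects the term at
   [j = 0]. *)
apply: (@cvg_series_abel R _ (fun j => 'C((j + q)%N, q)%:R * series harmonic j +
   q.+1%:R^-1 * ('C((j + q)%N, q)%:R - (j == 0)%:R))) => //.
- by move=> n; rewrite mulr_ge0.
- by rewrite /series/= !big_geq// !add0n !binn subrr !mulr0 addr0.
- move=> n; rewrite subr0 addSn binS natrD seriesSr -addSnnS mulrDl mulrDr.
  rewrite -!addrA; congr (_ + _); rewrite addrC; congr (_ + _).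
  have h : q.+1%:R * 'C((n.+1 + q)%N, q.+1)%:R =
      n.+1%:R * 'C((n.+1 + q)%N, q)%:R :> R.
    by rewrite -!natrM mul_bin_left addnK.
  apply: (@mulfI _ (q.+1%:R * n.+1%:R)); first by rewrite mulf_neq0.
  rewrite /=.
  transitivity (q.+1%:R * 'C((n.+1 + q)%N, q.+1)%:R : R).
    by field; rewrite nat1r pnatr_eq0.
  by rewrite h; field; rewrite nat1r pnatr_eq0.
rewrite (_ : series _ = (fun N =>
  series (fun j => 'C((j + q)%N, q)%:R * series harmonic j * x ^+ j) N +
  q.+1%:R^-1 * (series (fun j => 'C((j + q)%N, q)%:R * x ^+ j) N -
    series (fun j => (j == 0)%:R * x ^+ j) N))); last first.
  apply/funext => N; rewrite /series/= -sumrB mulr_sumr -big_split/=.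
  by apply: eq_bigr => i _; ring.
apply: cvgD; first exact: IH.
apply: cvgMl_tmp; apply: cvgB; first exact: cvg_series_bin.
exact: cvg_series_delta0.
Qed.

(** * The Gamma function *)

Definition Gamma_integrand (R : realType) (x t : R) : R :=
  t `^ (x - 1) * expR (- t).

Lemma is_derive1_powR_expRN (R : realType) (x t : R) : 0 < t ->
  is_derive t 1 (fun t => t `^ x * expR (- t))
    (x * Gamma_integrand x t - Gamma_integrand (x + 1) t).
Proof.
move=> t0.
have h1 := is_derive1_powR x t0.
have h2 : is_derive t (1:R) (fun t => expR (- t)) (- expR (- t)).
  have dN : is_derive t (1:R) (fun t : R => - t) (-1).
    by apply: is_derive_eq.
  have := @is_derive1_comp _ (@expR R) (fun t =>
      - t) t _ _ (is_derive_expR (- t)) dN.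
  by rewrite mulrN1.
apply: is_derive_eq (is_deriveM h1 h2) _.
by rewrite /GRing.scale/= /Gamma_integrand addrK; ring.
Qed.

Lemma continuous_Gamma_integrand (R : realType) (x t : R) : 0 < t ->
  {for t, continuous (Gamma_integrand x)}.
Proof.
move=> t0; rewrite /Gamma_integrand.
have [d _] := is_derive1_powR_expRN (x - 1) t0.
by apply/differentiable_continuous; apply/derivable1_diffP.
Qed.

Lemma Gamma_integrand_ge0 (R : realType) (x t : R) : 0 <= Gamma_integrand x t.
Proof. by rewrite mulr_ge0 ?powR_ge0 ?expR_ge0. Qed.

Lemma within_continuous_Gamma_integrand (R : realType) (x a b : R) : 0 < a ->
  {within `[a, b], continuous (Gamma_integrand x)}.
Proof.
move=> a0; apply: continuous_in_subspaceT => t.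
rewrite inE/= in_itv/= => /andP[at_ _].
by apply: continuous_Gamma_integrand; exact: lt_le_trans at_.
Qed.

(** The fundamental theorem of calculus for t^x e^(-t), on a segment that avoids the possible
    singularity at 0. *)
Lemma Gamma_integral_by_parts (R : realType) (x a b : R) : 0 < a -> a < b ->
  (\int[lebesgue_measure]_(t in `[a, b]) (Gamma_integrand (x + 1) t)%:E +
   (b `^ x * expR (- b) - a `^ x * expR (- a))%:E =
   x%:E * \int[lebesgue_measure]_(t in `[a, b]) (Gamma_integrand x t)%:E)%E.
Proof.
move=> a0 ab.
have int_ y : (@lebesgue_measure R).-integrable `[a, b]
    (EFin \o Gamma_integrand y).
  apply: continuous_compact_integrable; first exact: segment_compact.
  exact: within_continuous_Gamma_integrand.
have cF t : 0 < t -> {for t, continuous (fun t : R => t `^ x * expR (- t))}.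
  by move=> t0; have := @continuous_Gamma_integrand R (x + 1) t t0;
      rewrite /Gamma_integrand addrK.
have := @continuous_FTC2 R (fun t =>
    x * Gamma_integrand x t - Gamma_integrand (x + 1) t)
  (fun t => t `^ x * expR (- t)) a b ab.
rewrite -EFinB => <-.
- under [X in (_ + X)%E]eq_integral do rewrite EFinB.
  rewrite integralB//=; last 2 first.
  - exact: (@integrableZl _ _ _ lebesgue_measure `[a, b]
      (measurable_itv _) x _ (int_ x)).
  - exact: int_.
  under [X in (_ + (X - _))%E]eq_integral do rewrite EFinM.
  rewrite integralZl; [|exact: measurable_itv|exact: int_].
  rewrite addeCA subee ?adde0//.
  by have := integrable_fin_num _ (int_ (x + 1)); apply; exact: measurable_itv.
- apply: continuous_in_subspaceT => t.
  rewrite inE/= in_itv/= => /andP[at_ _].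
  have t0 := lt_le_trans a0 at_.
  by apply: cvgB; [apply: cvgMl_tmp|]; exact: continuous_Gamma_integrand.
- split.
  + move=> t; rewrite in_itv/= => /andP[at_ _].
    by have [] := is_derive1_powR_expRN x (lt_trans a0 at_).
  + by apply: cvg_at_right_filter; exact: cF.
  + by apply: cvg_at_left_filter; apply: cF; exact: lt_trans ab.
- move=> t; rewrite in_itv/= => /andP[at_ _].
  have := is_derive1_powR_expRN x (lt_trans a0 at_).
  by move=> [_ <-]; rewrite derive1E.
Qed.

Lemma measurable_Gamma_integrand (R : realType) (x : R) (D : set R) :
  measurable D -> measurable_fun D (Gamma_integrand x).
Proof.
move=> mD; apply: measurable_funM.
  by apply: measurable_funTS; exact: measurable_powR.
by apply: measurable_funTS; apply: measurableT_comp.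
Qed.

Lemma expRN_exprn_le (R : realType) (n : nat) (t : R) : 0 < t ->
  t ^+ n * expR (- t) <= n.+1`!%:R / t.
Proof.
move=> t0; rewrite expRN ler_pdivrMr ?expR_gt0// mulrAC ler_pdivlMr// -exprSr.
rewrite -ler_pdivrMl ?ltr0n ?fact_gt0// mulrC.
by rewrite (le_trans _ (expR_ge1Dxn n (ltW t0)))// lerDr.
Qed.

Lemma cvg_powR_expRN_pinfty (R : realType) (x : R) :
  (n.+2%:R : R) `^ x * expR (- n.+2%:R) @[n --> \oo] --> 0.
Proof.
have [N xN] : exists N : nat, x <= N%:R.
  by exists (Num.bound `|x|);
      rewrite (le_trans (ler_norm _))// ltW// archi_boundP.
apply: (@squeeze_cvgr _ _ _ _ (cst 0) (fun n => N.+1`!%:R * harmonic n)).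
- near=> n; rewrite mulr_ge0 ?powR_ge0 ?expR_ge0//=.
  apply: (@le_trans _ _ (n.+2%:R ^+ N * expR (- n.+2%:R))).
    by rewrite ler_wpM2r ?expR_ge0// -powR_mulrn// ler_powR// ler1n.
  apply: le_trans (expRN_exprn_le _ _) _ => //.
  by rewrite ler_wpM2l// lef_pV2 ?posrE// ler_nat.
- exact: cvg_cst.
- by rewrite -[X in _ --> X](mulr0 (N.+1`!%:R));
    apply: cvgMl_tmp; exact: cvg_harmonic.
Unshelve. all: by end_near. Qed.

Lemma cvg_powR_expRN_0 (R : realType) (x : R) : 0 < x ->
  (n.+2%:R^-1 : R) `^ x * expR (- n.+2%:R^-1) @[n --> \oo] --> 0.
Proof.
move=> x0.
have h : n.+2%:R^-1 @[n --> \oo] --> (0:R).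
  by rewrite (cvg_shiftS (@harmonic R)); exact: cvg_harmonic.
have h2 : (n.+2%:R^-1 : R) `^ x @[n --> \oo] --> 0.
  have /cvg_at_rightP := powR_cvg0 x0; apply; split => // n.
apply: (@squeeze_cvgr _ _ _ _ (cst 0) (fun n => (n.+2%:R^-1 : R) `^ x)).
- near=> n; rewrite mulr_ge0 ?powR_ge0 ?expR_ge0//=.
  by rewrite ler_piMr ?powR_ge0// expR_le1 oppr_le0.
- exact: cvg_cst.
- exact: h2.
Unshelve. all: by end_near. Qed.

(** Monotone convergence along segments exhausting the half-line. The shift to [n.+2] keeps the
    endpoints distinct already at [n = 0], as the integration by parts requires. *)
Lemma cvg_Gamma_integral (R : realType) (x : R) :
  (\int[lebesgue_measure]_(t in `[(n.+2%:R^-1)%R, (n.+2%:R)%R])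
      (Gamma_integrand x t)%:E @[n --> \oo] -->
  \int[lebesgue_measure]_(t in `]0%R, +oo[) (Gamma_integrand x t)%:E)%E.
Proof.
have -> : `]0, +oo[%classic = \bigcup_n `[n.+2%:R^-1, n.+2%:R]%classic :> set R.
  apply/seteqP; split => t /=; rewrite in_itv/=.
    rewrite andbT => t0.
    pose N := Num.bound (Num.max t t^-1).
    have hN : Num.max t t^-1 < N%:R.
      by rewrite archi_boundP// le_max (ltW t0).
    exists N => //=; rewrite in_itv/=.
    have N2 : N%:R <= N.+2%:R :> R by rewrite ler_nat -addn2 leq_addr.
    move: hN; rewrite gt_max => /andP[tN tVN].
    rewrite (le_trans (ltW tN) N2) andbT.
    by rewrite -[leRHS]invrK lef_pV2 ?posrE ?invr_gt0// (le_trans (ltW tVN) N2).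
  move=> [n _ /=]; rewrite in_itv/= => /andP[nt _]; rewrite andbT.
  by rewrite (lt_le_trans _ nt)// invr_gt0.
apply: ge0_nondecreasing_set_cvg_integral => //.
- apply/nondecreasing_seqP => n; rewrite subsetEset.
  apply: subset_itv; rewrite bnd_simp; last by rewrite ler_nat.
  by rewrite lef_pV2 ?posrE// ler_nat.
- by move=> n; apply/measurable_EFinP; exact: measurable_Gamma_integrand.
- by move=> n t _; rewrite lee_fin Gamma_integrand_ge0.
Qed.

(** The boundary terms vanish along the exhausting segments. Stated in the extended reals, the
    equation also carries finiteness from [x] to [x + 1]. *)
Lemma Gamma_integralS (R : realType) (x : R) : 0 < x ->
  (\int[lebesgue_measure]_(t in `]0%R, +oo[) (Gamma_integrand (x + 1) t)%:E =
   x%:E * \int[lebesgue_measure]_(t in `]0%R, +oo[) (Gamma_integrand x t)%:E)%E.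
Proof.
move=> x0.
have cvl := @cvg_Gamma_integral R (x + 1).
have cvr := cvgeZl (y := x%:E) isT (@cvg_Gamma_integral R x).
suff cvl2 : (x%:E * \int[lebesgue_measure]_(t in `[(n.+2%:R^-1)%R, (n.+2%:R)%R])
    (Gamma_integrand x t)%:E @[n --> \oo] -->
    \int[lebesgue_measure]_(t in `]0%R, +oo[) (Gamma_integrand (x + 1) t)%:E)%E.
  exact: (cvg_unique (@ereal_hausdorff R) cvl2 cvr).
rewrite -[X in _ --> X]adde0.
under eq_fun => n.
  rewrite -Gamma_integral_by_parts//; last first.
    by rewrite (@lt_trans _ _ 1)// ?invf_lt1// ltr1n.
  over.
apply: cvgeD => //; first by rewrite fin_num_adde_defl.
apply: cvg_EFin; first by near=> n.
rewrite -[X in _ --> X](subr0 (0:R)); apply: cvgB.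
  exact: cvg_powR_expRN_pinfty.
exact: cvg_powR_expRN_0.
Unshelve. all: by end_near. Qed.

Lemma GammaS (R : realType) (x : R) : 0 < x -> Gamma (x + 1) = x * Gamma x.
Proof.
move=> x0; rewrite /Gamma /Rintegral.
have /= -> := Gamma_integralS x0.
rewrite /Gamma_integrand.
have : (0 <= \int[lebesgue_measure]_(t in `]0%R, +oo[)
    (Gamma_integrand x t)%:E)%E.
  by apply: integral_ge0 => t _; rewrite lee_fin Gamma_integrand_ge0.
rewrite /Gamma_integrand.
(* If the integral is infinite, both sides have real value 0; nonnegativity excludes minus
   infinity. *)
case: (\int[_]_(_ in _) _)%E => [r _ //| _|//].
by rewrite gt0_muley ?lte_fin//= mulr0.
Qed.

(** The integrand at 1 is the exponential density of rate 1, whose total mass is 1. *)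
Lemma Gamma_integral1 (R : realType) :
  (\int[@lebesgue_measure R]_(t in `]0%R, +oo[) (Gamma_integrand 1 t)%:E = 1)%E.
Proof.
rewrite -(@integral_exponential_pdf R 1 ltr01) /exponential_pdf.
rewrite integral_itv_obnd_cbnd; last first.
  by apply/measurable_EFinP; exact: measurable_Gamma_integrand.
rewrite integral_mkcond; apply: eq_integral => x _.
rewrite !patchE; case: ifPn => // _.
by rewrite /Gamma_integrand subrr powRr0 !mul1r mulN1r.
Qed.

Lemma Gamma_integral_nat (R : realType) (n : nat) :
  (\int[@lebesgue_measure R]_(t in `]0%R, +oo[) (Gamma_integrand n.+1%:R t)%:E =
   (n`!)%:R%:E)%E.
Proof.
elim: n => [|n IH]; first by rewrite fact0 Gamma_integral1.
by rewrite -natr1 Gamma_integralS// IH -EFinM -natrM factS.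
Qed.

Lemma Gamma_nat (R : realType) (n : nat) : Gamma (n.+1%:R : R) = (n`!)%:R.
Proof. by rewrite /Gamma /Rintegral; have /= -> := Gamma_integral_nat R n. Qed.

Lemma integrable_Gamma_integrand_nat (R : realType) (n : nat) :
  (@lebesgue_measure R).-integrable `]0%R, +oo[
    (EFin \o Gamma_integrand n.+1%:R).
Proof.
apply/integrableP; split.
  by apply/measurable_EFinP; exact: measurable_Gamma_integrand.
under eq_integral do rewrite /= ger0_norm ?Gamma_integrand_ge0//.
by rewrite Gamma_integral_nat ltry.
Qed.

(** * Derivatives of Gamma and digamma at the positive integers *)

Lemma is_derive1_powRr (R : realType) (a x : R) : 0 < a ->
  is_derive x 1 (fun x => a `^ x) (ln a * a `^ x).
Proof.
move=> a0.
have dl : is_derive x (1:R) (fun x : R => ln a * x) (ln a).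
  by have := is_derive1_scale (ln a) (is_derive_id x (1:R)); rewrite mulr1.
have h := @is_derive1_comp _ (@expR R) (fun x =>
    ln a * x) x _ _ (is_derive_expR _) dl.
rewrite (_ : (fun x => a `^ x) = (fun x => expR (ln a * x))); last first.
  by apply/funext => u; rewrite /powR gt_eqF// mulrC.
by apply: is_derive_eq h _; rewrite /powR gt_eqF// (mulrC x); ring.
Qed.

Lemma is_derive1_Gamma_integrand (R : realType) (x t : R) : 0 < t ->
  is_derive x 1 (fun x => Gamma_integrand x t) (ln t * Gamma_integrand x t).
Proof.
move=> t0.
have h := @is_derive1_comp _ (fun x => t `^ x) (fun x => x - 1) x _ _
  (is_derive1_powRr (x - 1) t0) (is_derive_shift x 1 (-1)).
have h2 := is_derive1_scale (expR (- t)) h.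
rewrite (_ : (fun x => _) = (fun x => expR (- t) * t `^ (x - 1))); last first.
  by apply/funext => u; rewrite /Gamma_integrand mulrC.
by apply: is_derive_eq h2 _; rewrite /Gamma_integrand mulr1; ring.
Qed.

Lemma powR_le_nat (R : realType) (m n : nat) (x t : R) : 0 < t ->
  m%:R <= x <= n%:R -> t `^ x <= Num.max (t ^+ m) (t ^+ n).
Proof.
move=> t0 /andP[mx xn]; rewrite le_max; have [t1|t1] := leP 1 t.
  by rewrite -(powR_mulrn n (ltW t0)) ler_powR// orbT.
by rewrite -(powR_mulrn m (ltW t0)) ger_powR// ?t0 ltW.
Qed.

(* At 3 the singularity of [ln t] at 0 is absorbed by [t `^ (x - 1)]; the other
   integers are reached through the functional equation. *)
Lemma derivable_Gamma3 (R : realType) : derivable (@Gamma R) 3 1.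
Proof.
(* [G t] is (1 + t^4) e^(-t). For 2 < x < 4 it dominates the integrand and its derivative in x,
   because t^(x-1) is at most max(t, t^3), and |ln t| is at most t for t >= 1 and at most 1 / t for
   t < 1. *)
pose G (t : R) := Gamma_integrand 1 t + Gamma_integrand 5 t.
have intG : (@lebesgue_measure R).-integrable `]0%R, +oo[ (EFin \o G).
  rewrite (_ : _ \o _ = (fun x =>
      (EFin \o Gamma_integrand 1) x + (EFin \o Gamma_integrand 5) x)%E) //.
  apply: integrableD => //.
    exact: (integrable_Gamma_integrand_nat R 0).
  exact: (integrable_Gamma_integrand_nat R 4).
have GE (t : R) : 0 < t -> G t = (1 + t ^+ 4) * expR (- t).
  move=> t0; rewrite /G /Gamma_integrand subrr powRr0.
  rewrite (_ : 5 - 1 = 4%:R); last by ring.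
  by rewrite powR_mulrn ?ltW// -mulrDl.
have Gb (x t : R) : 2 < x < 4 -> 0 < t ->
    Gamma_integrand x t <= G t /\ `|ln t| * Gamma_integrand x t <= G t.
  move=> /andP[x2 x4] t0; rewrite GE// /Gamma_integrand mulrA.
  rewrite !ler_pM2r ?expR_gt0//.
  have tx : t `^ (x - 1) <= Num.max (t ^+ 1) (t ^+ 3).
    by apply: powR_le_nat => //; apply/andP; split; lra.
  rewrite expr1 in tx.
  have p0 := powR_ge0 t (x - 1).
  have [t1|t1] := leP 1 t.
    have t3 : t `^ (x - 1) <= t ^+ 3.
      apply: le_trans tx _; rewrite ge_max lexx andbT.
      by rewrite -[leLHS]expr1 ler_weXn2l.
    have tt : ln t <= t by rewrite ltW// ln_sublinear.
    rewrite ger0_norm ?ln_ge0//; split.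
      apply: le_trans t3 _.
      by rewrite (@le_trans _ _ (t ^+ 4)) ?ler_weXn2l// lerDr.
    rewrite (@le_trans _ _ (t * t ^+ 3))//; last by rewrite -exprS lerDr.
    by apply: ler_pM => //; exact: ln_ge0.
  have t3 : t `^ (x - 1) <= t.
    apply: le_trans tx _; rewrite ge_max lexx /=.
    by rewrite -[leRHS]expr1 ler_wiXn2l ?ltW.
  have tt : - ln t <= t^-1.
    by rewrite -lnV ?posrE// ltW// ln_sublinear ?invr_gt0.
  have t40 : 0 <= t ^+ 4 by rewrite exprn_ge0 ?ltW.
  rewrite ler0_norm ?ln_le0 ?(ltW t1)//; split.
    by apply: le_trans t3 _; rewrite (le_trans (ltW t1))// lerDl.
  rewrite (@le_trans _ _ (t^-1 * t))//; last by rewrite mulVf ?gt_eqF// lerDl.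
  by apply: ler_pM => //; rewrite oppr_ge0 ln_le0// ltW.
apply: (@derivable_under_integral R _ _ lebesgue_measure (@Gamma_integrand R)
  `]0%R, +oo[%classic (measurable_itv _) 3 2 4 _ _ _ G) => //.
- by rewrite /= in_itv/= !ltr_nat.
- move=> x; rewrite /= in_itv/= => x24.
  apply: le_integrable intG => //.
    by apply/measurable_EFinP; exact: measurable_Gamma_integrand.
  move=> t; rewrite /= in_itv/= andbT => t0.
  rewrite lee_fin ger0_norm ?Gamma_integrand_ge0// ger0_norm ?addr_ge0
      ?Gamma_integrand_ge0//.
  by have [] := Gb x t x24 t0.
- move=> x t _; rewrite /= in_itv/= andbT => t0.
  by have [] := is_derive1_Gamma_integrand x t0.
- by move=> t; rewrite addr_ge0 ?Gamma_integrand_ge0.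
- move=> x t; rewrite /= !in_itv/= andbT => x24 t0.
  have [_ h] := is_derive1_Gamma_integrand x t0.
  rewrite /partial1of2 derive1E h normrM.
  rewrite [X in _ * X]ger0_norm ?Gamma_integrand_ge0//.
  by have [] := Gb x t x24 t0.
Qed.

(* [G] is abstract because unification would unfold the integral in [Gamma]. *)
Lemma is_derive1_shift_eq (R : realType) (G : R -> R) (x : R) :
  (forall u, 0 < u -> G (u + 1) = u * G u) -> 0 < x ->
  derivable G x 1 ->
  is_derive (x + 1) 1 G (G x + x * derive1 G x).
Proof.
move=> GS x0 dG.
have h0 : is_derive x (1:R) G (derive1 G x).
  by apply: DeriveDef => //; rewrite derive1E.
have h1 : is_derive (x + 1) (1:R) (fun u => G (u - 1)) (derive1 G x).
  rewrite -[X in is_derive _ _ _ X]mulr1.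
  apply: (@is_derive1_comp _ G (fun u => u - 1)).
    by rewrite addrK.
  exact: is_derive_shift.
have h2 := is_deriveM (is_derive_shift (x + 1) (1:R) (-1)) h1.
have h3 : is_derive (x + 1) 1 (fun u => (u - 1) * G (u - 1))
    (G x + x * derive1 G x).
  by apply: is_derive_eq h2 _; rewrite /GRing.scale/= addrK mulr1 addrC.
apply: near_eq_is_derive h3.
near=> u.
rewrite -GS ?subrK// subr_gt0.
near: u; apply: lt_nbhsr; rewrite ltrDr//.
Unshelve. all: by end_near. Qed.

(** Near [x] the functional equation reads G u = G (u + 1) / u, which transports derivability
    downwards, from 3 to 2 and then to 1. *)
Lemma derivable_shift_eq (R : realType) (G : R -> R) (x : R) :
  (forall u, 0 < u -> G (u + 1) = u * G u) -> 0 < x ->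
  derivable G (x + 1) 1 -> derivable G x 1.
Proof.
move=> GS x0 dG.
have h1 : is_derive x (1:R) (fun u => G (u + 1)) ('D_1 G (x + 1)).
  rewrite -[X in is_derive _ _ _ X]mulr1.
  by apply: (@is_derive1_comp _ G (fun u =>
      u + 1)); [exact: DeriveDef|exact: is_derive_shift].
have [h2 _] := h1.
have h3 : derivable ((fun u => u^-1) * (fun u => G (u + 1))) x 1.
  apply: derivableM; last exact: h2.
  by apply: derivableV; [exact: lt0r_neq0|exact: derivable_id].
apply: near_eq_derivable h3.
near=> u.
have u0 : 0 < u by near: u; exact: lt_nbhsr.
change (u^-1 * G (u + 1) = G u).
by rewrite GS// mulrA mulVf ?mul1r// gt_eqF.
Unshelve. all: by end_near. Qed.

Lemma derivable_Gamma_nat (R : realType) (n : nat) :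
  derivable (@Gamma R) n.+1%:R 1.
Proof.
have d3 := @derivable_Gamma3 R.
rewrite (_ : 3 = 2 + 1) in d3; last by ring.
have d2 := derivable_shift_eq (@GammaS R) (ltr0Sn R 1) d3.
have d1 : derivable (@Gamma R) 1 1.
  exact: (derivable_shift_eq (@GammaS R) ltr01 d2).
elim: n => [|n IH]; first exact: d1.
rewrite -natr1.
by have [] := is_derive1_shift_eq (@GammaS R) (ltr0Sn R n) IH.
Qed.

(** The logarithmic derivative of the functional equation adds 1 / (n + 1) at each step. *)
Lemma digamma_nat (R : realType) (n : nat) :
  digamma (n.+1%:R : R) = digamma 1 + series harmonic n.
Proof.
elim: n => [|n IH]; first by rewrite /series/= big_geq// addr0.
rewrite seriesSr addrA -IH /digamma -natr1 GammaS// derive1E.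
have [_ ->] := is_derive1_shift_eq (@GammaS R) (ltr0Sn R n)
    (@derivable_Gamma_nat R n).
have G0 : Gamma n.+1%:R != 0 :> R by rewrite Gamma_nat pnatr_eq0 -lt0n fact_gt0.
by rewrite /=; field; rewrite G0 nat1r pnatr_eq0.
Qed.

(** * The Riemann zeta function *)

(** A second-order Taylor bound obtained from 1 + u <= e^u alone, used at u and at -u. *)
Lemma expR_sub1D_bounds (R : realType) (u : R) :
  0 <= expR u - 1 - u <= u ^+ 2 * expR `|u|.
Proof.
have h1 := expR_ge1Dx u.
have h2 := expR_ge1Dx (- u).
have e0 := expR_gt0 u.
have e1 : expR u * expR (- u) = 1 by rewrite expRxMexpNx_1.
have h3 : expR u - 1 <= u * expR u.
  have : expR u * (1 - u) <= expR u * expR (- u) by rewrite ler_pM2l.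
  by rewrite e1; lra.
apply/andP; split; first by lra.
have [u0|u0] := leP 0 u.
  rewrite ger0_norm//.
  have : u * (expR u - 1) <= u * (u * expR u) by rewrite ler_wpM2l.
  by rewrite expr2 -mulrA; lra.
rewrite ltr0_norm//.
have E1 : 1 <= expR (- u) by lra.
have : u ^+ 2 <= u ^+ 2 * expR (- u) by rewrite ler_peMr ?sqr_ge0.
have : u * (expR u - 1) <= u * u by rewrite ler_nM2l//; lra.
by rewrite -expr2; lra.
Qed.

Lemma cvg_series_le (R : realType) (u v : R^nat) :
  (forall n, 0 <= u n <= v n) -> cvgn (series v) -> cvgn (series u).
Proof.
move=> uv; apply: series_le_cvg => n; have /andP[u0 vu] := uv n => //.
exact: le_trans vu.
Qed.

Lemma is_cvg_series_inv_sqr (R : realType) :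
  cvgn (series (fun k => (k.+1%:R ^- 2 : R))).
Proof.
apply: nondecreasing_is_cvgn.
  by apply: nondecreasing_series => n _ _; rewrite invr_ge0 exprn_ge0.
(* Subtracting [n.+1%:R^-1] from the bound 2 is what makes the induction close. *)
have H n : series (fun k => (k.+1%:R ^- 2 : R)) n.+1 <= 2 - n.+1%:R^-1.
  elim: n => [|n IH]; first by rewrite /series/= big_nat1 expr1n invr1; lra.
  rewrite seriesSr (le_trans (lerD IH (lexx _)))// -subr_ge0.
  have -> : 2 - n.+2%:R^-1 - (2 - n.+1%:R^-1 + n.+2%:R ^- 2) =
      n.+1%:R^-1 * n.+2%:R ^- 2 :> R.
    rewrite -[n.+2%:R]natr1; field.
    by rewrite !nat1r natr1 !pnatr_eq0.
  by rewrite mulr_ge0 ?invr_ge0 ?exprn_ge0.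
exists 2 => _ [n _ <-]; case: n => [|n]; first by rewrite /series/= big_geq.
by rewrite (le_trans (H n))// gerBl invr_ge0.
Qed.

Lemma is_cvg_series_zeta (R : realType) (s : R) : 2 <= s ->
  cvgn (series (fun k => k.+1%:R `^ (- s) : R)).
Proof.
move=> s2; apply: (cvg_series_le _ (@is_cvg_series_inv_sqr R)) => k.
rewrite powR_ge0/= -powR_invn// ler_powR//; first by rewrite ler1n.
by rewrite lerN2.
Qed.

Lemma cvg_series_zeta (R : realType) (s : R) : 2 <= s ->
  series (fun k => k.+1%:R `^ (- s)) @ \oo --> riemann_zeta s.
Proof.
move=> s2; have /cvg_ex[l cvl] := is_cvg_series_zeta s2.
suff -> : riemann_zeta s = l by [].
apply: (cvg_lim (@Rhausdorff R)); rewrite -cvg_shiftS.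
by under eq_fun do rewrite big_add1.
Qed.

Lemma cvg_series_zeta_nat (R : realType) (n : nat) : (2 <= n)%N ->
  series (fun k => k.+1%:R ^- n) @ \oo --> riemann_zeta (n%:R : R).
Proof.
move=> n2; have := @cvg_series_zeta R n%:R.
rewrite ler_nat => /(_ n2).
by under [X in series X]eq_fun do rewrite powR_invn//.
Qed.

Lemma cvg_series_zeta_sub1 (R : realType) (n : nat) : (2 <= n)%N ->
  series (fun k => k.+2%:R ^- n) @ \oo --> riemann_zeta (n%:R : R) - 1.
Proof.
move=> n2.
rewrite (_ : series _ = (fun N => series (fun k =>
    (k.+1%:R : R) ^- n) N.+1 - 1)).
  apply: cvgB; last exact: cvg_cst.
  by rewrite (cvg_shiftS (series _)); exact: cvg_series_zeta_nat.
apply/funext => N.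
by rewrite /series/= big_nat_recl// expr1n invr1 [1 + _]addrC addrK.
Qed.

(** Comes from ln y < y at y = (k + 1)^(1/4). The exponent 1/2 is what [zeta_term_diff] can
    afford. *)
Lemma ln_sqr_le (R : realType) (k : nat) :
  ln (k.+1%:R : R) ^+ 2 <= 16 * k.+1%:R `^ 2^-1.
Proof.
have h : ln (k.+1%:R : R) = 4 * ln (k.+1%:R `^ 4^-1).
  by rewrite ln_powR; field.
have p0 : 0 < (k.+1%:R : R) `^ 4^-1 by rewrite powR_gt0.
have -> : (k.+1%:R : R) `^ 2^-1 = (k.+1%:R `^ 4^-1) ^+ 2.
  by rewrite -powR_mulrn ?powR_ge0// -powRrM; congr (_ `^ _); field.
rewrite h exprMn.
have -> : 4 ^+ 2 = 16 :> R by ring.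
have l0 : 0 <= ln ((k.+1%:R : R) `^ 4^-1).
  by rewrite ln_powR mulr_ge0 ?invr_ge0// ln_ge0// ler1n.
by rewrite ler_pM2l// lerXn2r ?nnegrE ?(ltW p0)// ltW// ln_sublinear.
Qed.

(** The logarithm costs at most one power of k + 1, so an exponent of at least 3 leaves the
    convergent series of inverse squares. *)
Lemma cvg_series_ln_zeta (R : realType) (s : R) : 3 <= s ->
  cvgn (series (fun k => ln k.+1%:R * k.+1%:R `^ (- s) : R)).
Proof.
move=> s3; apply: (cvg_series_le _ (@is_cvg_series_inv_sqr R)) => k.
have k1 : 1 <= k.+1%:R :> R by rewrite ler1n.
rewrite mulr_ge0 ?powR_ge0 ?ln_ge0//=.
rewrite (@le_trans _ _ (k.+1%:R * k.+1%:R `^ (- 3)))//.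
  apply: ler_pM; rewrite ?powR_ge0 ?ln_ge0//.
    by rewrite ltW// ln_sublinear.
  by rewrite ler_powR// lerN2.
rewrite powR_invn// exprS invfM mulrA mulfV ?pnatr_eq0// mul1r.
exact: lexx.
Qed.

(** Taylor remainder of K^-s exp(-h ln K) in h. Both (ln K)^2 and exp(|h| ln K) cost a factor
    K^(1/2), up to the constant 16, and K^(1-s) <= K^-2 for s >= 3. *)
Lemma zeta_term_diff (R : realType) (s h : R)
    (k : nat) : 3 <= s -> `|h| <= 2^-1 ->
  `|k.+1%:R `^ (- (s + h)) - k.+1%:R `^ (- s) +
      h * (ln k.+1%:R * k.+1%:R `^ (- s))|
    <= 16 * h ^+ 2 * k.+1%:R ^- 2.
Proof.
move=> s3 h2.
have k1 : 1 <= k.+1%:R :> R by rewrite ler1n.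
set K : R := k.+1%:R.
have K0 : 0 < K by rewrite ltr0n.
have l0 : 0 <= ln K by exact: ln_ge0.
have -> : K `^ (- (s + h)) = K `^ (- s) * expR (- (h * ln K)).
  rewrite opprD powRD ?(gt_eqF K0) ?implybT//; congr (_ * _).
  by rewrite {1}/powR gt_eqF// mulNr.
have -> : K `^ (- s) * expR (- (h * ln K)) - K `^ (- s) +
    h * (ln K * K `^ (- s)) =
  K `^ (- s) * (expR (- (h * ln K)) - 1 - - (h * ln K)) by ring.
have /andP[e0 eb] := expR_sub1D_bounds (- (h * ln K)).
rewrite ger0_norm ?mulr_ge0 ?powR_ge0//.
rewrite sqrrN normrN normrM (ger0_norm l0) exprMn in eb.
have eK : expR (`|h| * ln K) <= K `^ 2^-1.
  by rewrite /powR gt_eqF// ler_expR ler_wpM2r.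
have lK := ln_sqr_le R k; rewrite -/K in lK.
apply: (@le_trans _ _ (K `^ (- s) * (h ^+ 2 * (16 * K `^ 2^-1) * K `^ 2^-1))).
  rewrite ler_wpM2l ?powR_ge0// (le_trans eb)//.
  apply: ler_pM => //.
  - by rewrite mulr_ge0 ?sqr_ge0.
  - by rewrite ler_wpM2l ?sqr_ge0.
have -> : K `^ (- s) * (h ^+ 2 * (16 * K `^ 2^-1) * K `^ 2^-1) =
    16 * h ^+ 2 * K `^ (1 - s).
  rewrite (_ : 1 - s = - s + 2^-1 + 2^-1); last by field.
  by rewrite !powRD ?(gt_eqF K0) ?implybT//; ring.
have -> : K ^- 2 = K `^ (- 2%:R) by rewrite powR_invn ?(ltW K0).
apply: ler_wpM2l; first by rewrite mulr_ge0 ?sqr_ge0.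
by rewrite ler_powR//; lra.
Qed.

(** Termwise differentiation: summing the previous bound over k leaves an error of order h^2,
    uniform in the number of terms. *)
Lemma is_derive1_zeta (R : realType) (s : R) : 3 <= s ->
  is_derive s 1 (@riemann_zeta R)
    (- limn (series (fun k => ln k.+1%:R * k.+1%:R `^ (- s)))).
Proof.
move=> s3.
have cvL := cvg_series_ln_zeta s3.
set L := limn _.
have s2 : 2 <= s by lra.
pose M := limn (series (fun k => (k.+1%:R ^- 2 : R))).
have bd h : `|h| <= 2^-1 -> `|riemann_zeta (s + h) - riemann_zeta s +
    h * L| <= 16 * h ^+ 2 * M.
  move=> h2.
  have sh2 : 2 <= s + h by have := ler_norm (- h); rewrite normrN; lra.
  have cv : series (fun k => k.+1%:R `^ (- (s + h)) - k.+1%:R `^ (- s) +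
      h * (ln k.+1%:R * k.+1%:R `^ (- s))) @ \oo -->
      riemann_zeta (s + h) - riemann_zeta s + h * L.
    have -> : series (fun k => k.+1%:R `^ (- (s + h)) - k.+1%:R `^ (- s) +
      h * (ln k.+1%:R * k.+1%:R `^ (- s))) =
      (fun N => series (fun k => k.+1%:R `^ (- (s + h))) N -
        series (fun k => k.+1%:R `^ (- s)) N +
        h * series (fun k => ln k.+1%:R * k.+1%:R `^ (- s)) N).
      by apply/funext => N; rewrite /series/= mulr_sumr -sumrB -big_split.
    apply: cvgD; last exact: cvgMl_tmp.
    by apply: cvgB; exact: cvg_series_zeta.
  have cvM : (fun N => 16 * h ^+ 2 * series (fun k =>
      (k.+1%:R ^- 2 : R)) N) @ \oo --> 16 * h ^+ 2 * M.
    by apply: cvgMl_tmp; exact: is_cvg_series_inv_sqr.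
  apply: ler_cvg_to (cvg_norm cv) cvM _.
  apply: nearW => N; rewrite (le_trans (ler_norm_sum _ _ _))//.
  by rewrite /series/= mulr_sumr; apply: ler_sum => k _; exact: zeta_term_diff.
have M0 : 0 <= M.
  by apply: limr_ge (@is_cvg_series_inv_sqr R) _; apply: nearW => n;
     apply: sumr_ge0 => i _; rewrite invr_ge0 exprn_ge0.
have cvD : (fun h => h^-1 *: (riemann_zeta (h *: 1 +
    s) - riemann_zeta s)) @ 0^' --> - L.
  apply/cvgrPdist_le => e e0.
  near=> h.
  have h0 : h != 0 by near: h; exact: nbhs_dnbhs_neq.
  have h2 : `|h| <= 2^-1 by near: h; apply: dnbhs0_le.
  rewrite /GRing.scale/= mulr1 [h + s]addrC.
  rewrite (_ : - L - h^-1 * _ =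
      - (h^-1 * (riemann_zeta (s + h) - riemann_zeta s + h * L))); last
          by field.
  rewrite normrN normrM normfV ler_pdivrMl ?normr_gt0//.
  rewrite (le_trans (bd h h2))// -real_normK ?num_real// expr2.
  rewrite (_ : _ * M = `|h| * (`|h| * (16 * M))); last by ring.
  rewrite ler_pM2l ?normr_gt0//.
  (* The added 1 keeps the denominator positive, since [M] is only known to be nonnegative. *)
  have : `|h| <= e / (16 * M + 1).
    near: h; apply: dnbhs0_le; rewrite divr_gt0// ltr_wpDl// mulr_ge0//.
  rewrite ler_pdivlMr ?ltr_wpDl ?mulr_ge0// mulrDr mulr1 => H.
  by rewrite (le_trans _ H)// lerDl.
apply: DeriveDef; first by apply/cvg_ex; exists (- L).
exact: (cvg_lim (@Rhausdorff R) cvD).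
Unshelve. all: by end_near. Qed.

(** * The integral of the square *)

Lemma is_derive1_sum (R : realType) (n : nat) (f df : nat -> R -> R) (x : R) :
  (forall i, is_derive x 1 (f i) (df i x)) ->
  is_derive x 1 (fun u => \sum_(0 <= i < n) f i u) (\sum_(0 <= i < n) df i x).
Proof.
move=> fdf; elim: n => [|n IH].
  rewrite big_geq// (_ : (fun u => _) = cst 0); first exact: is_derive_cst.
  by apply/funext => u; rewrite big_geq.
rewrite big_nat_recr//= (_ : (fun u => _) =
    (fun u => \sum_(0 <= i < n) f i u) + f n); first exact: is_deriveD.
by apply/funext => u; rewrite big_nat_recr.
Qed.

Section integral_zeta1_sqr.
Variables (R : realType) (p : nat).

(** Here [p] is m - 1 and [k] counts from 0, so the sum of all [zterm k x] is [zeta1] at m, and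
    [p.*2.+1] is 2m - 1. *)
Let zterm (k : nat) (x : R) : R := (x + k.+1%:R) ^- p.+1.

Lemma sum_sqr (a : nat -> R) (N : nat) : (\sum_(0 <= k < N) a k) ^+ 2 =
  \sum_(0 <= l < N) (a l ^+ 2 + 2 * \sum_(0 <= k < l) a k * a l).
Proof.
elim: N => [|N IH]; first by rewrite !big_geq// expr0n.
by rewrite !big_nat_recr//= -IH -mulr_suml; ring.
Qed.

(** Antiderivative of the square of the [N]-th partial sum: diagonal terms give powers, and the
    product of terms k < l gives minus a tail integral for the gap l - k. *)
Let primitive (N : nat) (x : R) : R := \sum_(0 <= l < N)
  (- (p.*2.+1%:R^-1 * (x + l.+1%:R) ^- p.*2.+1) -
   2 * \sum_(0 <= k < l) itail (l - k)%:R p p (x + k.+1%:R)).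

Let is_derive1_primitive (N : nat) (x : R) : 0 <= x ->
  is_derive x 1 (primitive N) ((\sum_(0 <= k < N) zterm k x) ^+ 2).
Proof.
move=> x0; rewrite sum_sqr.
have xk k : 0 < x + k.+1%:R by rewrite ltr_wpDl.
apply: (@is_derive1_sum R N _ (fun l x =>
    zterm l x ^+ 2 + 2 * \sum_(0 <= k < l) zterm k x * zterm l x)) => l.
have h1 := is_derive1_scale p.*2.+1%:R^-1 (is_derive1_exprNn p.*2 (lt0r_neq0
    (xk l))).
have h2 : is_derive x (1:R) (fun u =>
    \sum_(0 <= k < l) itail (l - k)%:R p p (u + k.+1%:R))
    (\sum_(0 <= k < l) - (zterm k x * zterm l x)).
  (* The guard is there because [is_derive1_sum] asks for a derivative at every index, while for
     [k >= l] the truncated gap would be 0. *)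
  rewrite (_ : (fun u => _) = (fun u => \sum_(0 <= k < l)
     (if (k < l)%N then itail (l - k)%:R p p (u + k.+1%:R) else 0)));
         last first.
    by apply/funext => u; apply: eq_big_nat => i /andP[_ ->].
  rewrite (_ : \sum_(0 <= k < l) _ =
      \sum_(0 <= k < l) if (k < l)%N then -
          (zterm k x * zterm l x) else 0); last first.
    by apply: eq_big_nat => i /andP[_ ->].
  apply: (@is_derive1_sum R l _ (fun k x =>
      if (k < l)%N then - (zterm k x * zterm l x) else 0)) => k.
  case: ifPn => kl; last exact: is_derive_cst.
  have lk0 : 0 < (l - k)%:R :> R by rewrite ltr0n subn_gt0.
  have h := @is_derive1_comp _ (itail (l - k)%:R p p) (fun u =>
      u + k.+1%:R) x _ _
    (is_derive1_itail p p lk0 (xk k)) (is_derive_shift x 1 k.+1%:R).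
  apply: is_derive_eq h _.
  have -> : x + k.+1%:R + (l - k)%:R = x + l.+1%:R.
    by rewrite -addrA -natrD (_ : (k.+1 + (l - k))%N = l.+1) //; lia.
  exact: mulr1.
have h := is_deriveB (is_deriveN h1) (is_derive1_scale 2 h2).
apply: is_derive_eq h _.
rewrite mulrA mulrN mulVf ?pnatr_eq0// mulN1r opprK sumrN mulrN opprK.
congr (_ + _); rewrite /zterm -!exprVn -exprM.
by congr (_ ^+ _); rewrite muln2.
Qed.

Let continuous_sum_zterm (N : nat) :
  {within `[0, 1], continuous (fun x => (\sum_(0 <= k < N) zterm k x) ^+ 2)}.
Proof.
apply: derivable_within_continuous => x; rewrite in_itv/= => /andP[x0 _].
have h : is_derive x (1:R) (fun u => \sum_(0 <= k < N) zterm k u)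
    (\sum_(0 <= k < N) (- p.+1%:R * (x + k.+1%:R) ^- p.+2)).
  apply: (@is_derive1_sum R N _ (fun k x =>
      - p.+1%:R * (x + k.+1%:R) ^- p.+2)) => k.
  by apply: is_derive1_exprNn; rewrite gt_eqF// ltr_wpDl.
have [h2 _] := @is_deriveX R R _ 2 x 1 _ h.
exact: h2.
Qed.

(** The diagonal telescopes in l. For a fixed gap d + 1, moving from x = 0 to x = 1 shifts the base
    point k + 1 by one, so the sum over k telescopes from base point 1 to N - d. *)
Let primitiveB (N : nat) : primitive N 1 - primitive N 0 =
  p.*2.+1%:R^-1 * (1 - N.+1%:R ^- p.*2.+1) +
  2 * \sum_(0 <= d < N) (itail d.+1%:R p p 1 - itail d.+1%:R p p (N - d)%:R).
Proof.
have -> : p.*2.+1%:R^-1 * (1 - N.+1%:R ^- p.*2.+1) =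
    \sum_(0 <= l < N) p.*2.+1%:R^-1 * (l.+1%:R ^- p.*2.+1 -
        l.+2%:R ^- p.*2.+1) :> R.
  rewrite -mulr_sumr; congr (_ * _).
  rewrite (eq_bigr (fun l =>
      - (l.+2%:R ^- p.*2.+1 - l.+1%:R ^- p.*2.+1))); last first.
    by move=> i _; rewrite opprB.
  rewrite sumrN (telescope_sumr (fun l => l.+1%:R ^- p.*2.+1 : R))//.
  by rewrite opprB expr1n invr1.
have -> : \sum_(0 <= d < N) (itail d.+1%:R p p 1 - itail d.+1%:R p p (N -
    d)%:R) =
    \sum_(0 <= l < N) \sum_(0 <= k < l)
      (itail (l - k)%:R p p k.+1%:R - itail (l - k)%:R p p k.+2%:R) :> R.
  elim: N => [|N IH]; first by rewrite !big_geq.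
  rewrite big_nat_recr//= subSnn subrr addr0 [in RHS]big_nat_recr//= -IH.
  (* Reversing the new row l = N indexes it by the gap, so that it extends each telescoping sum by
     one step. *)
  rewrite [X in _ = _ + X]big_nat_rev/= -big_split/=.
  apply: eq_big_nat => d /andP[_ dN].
  rewrite add0n (_ : (N - (N - d.+1))%N = d.+1); last by lia.
  rewrite (_ : (N - d.+1).+1 = (N - d)%N); last by lia.
  rewrite (_ : (N.+1 - d)%N = (N - d).+1); last by lia.
  by ring.
rewrite mulr_sumr -big_split/= /primitive -sumrB; apply: eq_bigr => l _.
rewrite sumrB nat1r add0r.
under eq_bigr do rewrite nat1r.
under [X in _ - (_ - 2 * X)]eq_bigr do rewrite add0r.
by ring.
Qed.

Lemma integral_sum_zterm_sqr (N : nat) :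
  (\int[lebesgue_measure]_(x in `[0%R, 1%R])
      (((\sum_(0 <= k < N) zterm k x) ^+ 2)%R)%:E =
  (p.*2.+1%:R^-1 * (1 - N.+1%:R ^- p.*2.+1) +
  2 * \sum_(0 <= d < N) (itail d.+1%:R p p 1 - itail d.+1%:R p p (N -
      d)%:R))%R%:E)%E.
Proof.
rewrite -primitiveB EFinB.
apply: continuous_FTC2 => //.
- split.
  + by move=> x; rewrite in_itv/= => /andP[x0 _];
      have [] := is_derive1_primitive N (ltW x0).
  + apply: cvg_at_right_filter.
    by have [/derivable1_diffP/differentiable_continuous] :=
        is_derive1_primitive N (lexx 0).
  + apply: cvg_at_left_filter.
    by have [/derivable1_diffP/differentiable_continuous] :=
        is_derive1_primitive N ler01.
- move=> x; rewrite in_itv/= => /andP[x0 _].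
  by have [_ <-] := is_derive1_primitive N (ltW x0); rewrite derive1E.
Qed.

(** * Passage to the limit in the number of terms *)

Hypothesis p0 : (0 < p)%N.

(** The base point N - d and the gap d + 1 add up to N + 1. By [itail_le] each of the N tails is at
    most (N + 1)^-2, and their sum at most 1 / (N + 1). *)
Let cvg_itail_tail :
  (fun N => \sum_(0 <= d < N) itail d.+1%:R p p (N - d)%:R) @ \oo --> (0 : R).
Proof.
apply: (@squeeze_cvgr _ _ _ _ (cst 0) (@harmonic R)).
- apply: nearW => N; apply/andP; split.
    rewrite big_nat_cond; apply: sumr_ge0 => d /andP[/andP[_ dN] _].
    by apply: itail_ge0 => //; rewrite ltr0n subn_gt0.
  apply: (@le_trans _ _ (\sum_(0 <= d < N) N.+1%:R ^- 2)); last first.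
    rewrite sumr_const_nat subn0 -[_ *+ N]mulr_natr /= expr2 invfM -mulrA
        ler_piMr//.
    by rewrite ler_pdivrMl// mulr1 ler_nat.
  rewrite big_nat_cond [leRHS]big_nat_cond;
      apply: ler_sum => d /andP[/andP[_ dN] _].
  have Nd : 0 < (N - d)%:R :> R by rewrite ltr0n subn_gt0.
  have Nd1 : 1 <= (N - d)%:R :> R by rewrite ler1n subn_gt0.
  case: p p0 => // p' _.
  apply: le_trans (itail_le p' p'.+1 (ltr0Sn R d) Nd) _.
  rewrite -natrD (_ : (N - d + d.+1)%N = N.+1); last by lia.
  rewrite -[leRHS]mul1r; apply: ler_pM;
      rewrite ?invr_ge0 ?exprn_ge0 ?(ltW Nd)//.
    by rewrite invf_le1 ?exprn_gt0// exprn_ege1.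
  by rewrite lef_pV2 ?posrE ?exprn_gt0// ler_weXn2l// ler1n.
- exact: cvg_cst.
- exact: cvg_harmonic.
Qed.

Lemma cvg_zeta1 (x : R) : 0 <= x ->
  (fun N => \sum_(0 <= k < N) zterm k x) @ \oo --> zeta1 p.+1%:R x.
Proof.
move=> x0.
have cv : cvgn (series (fun k => zterm k x)).
  apply: (cvg_series_le _ (@is_cvg_series_inv_sqr R)) => k.
  have k0 : 0 < k.+1%:R :> R by rewrite ltr0n.
  have xk : k.+1%:R <= x + k.+1%:R by rewrite lerDr.
  rewrite invr_ge0 exprn_ge0 ?addr_ge0//= lef_pV2 ?posrE ?exprn_gt0
      ?(lt_le_trans k0)//.
  apply: (@le_trans _ _ ((x + k.+1%:R) ^+ 2)).
    by rewrite lerXn2r ?nnegrE ?addr_ge0.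
  by rewrite ler_weXn2l// ?(le_trans _ xk) ?ler1n.
have /cvg_ex[l cvl] := cv.
suff -> : zeta1 p.+1%:R x = l by [].
apply: (cvg_lim (@Rhausdorff R)); rewrite -cvg_shiftS.
rewrite (_ : (fun n => _) = series (fun k => zterm k x))//.
apply/funext => n; rewrite big_add1/=; apply: eq_bigr => k _.
by rewrite addrC powR_invn// addr_ge0.
Qed.

(** Monotone convergence applies since the terms are nonnegative on [0, 1] and the squares of their
    partial sums increase. *)
Lemma integral_zeta1_sqr (S : R) :
  series (fun d => itail d.+1%:R p p 1) @ \oo --> S ->
  (\int[lebesgue_measure]_(x in `[0%R, 1%R]) ((zeta1 p.+1%:R x) ^+ 2)%:E =
   (p.*2.+1%:R^-1 + 2 * S)%:E)%E.
Proof.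
move=> cvS.
pose g N (x : R) := (((\sum_(0 <= k < N) zterm k x) ^+ 2)%R)%:E.
have zterm_ge0 k (x : R) : 0 <= x -> 0 <= zterm k x.
  by move=> x0; rewrite invr_ge0 exprn_ge0// addr_ge0.
have -> : (\int[lebesgue_measure]_(x in `[0%R, 1%R])
    ((zeta1 p.+1%:R x) ^+ 2)%:E =
  \int[lebesgue_measure]_(x in `[0%R, 1%R]) limn (g ^~ x))%E.
  apply: eq_integral => x; rewrite inE/= in_itv/= => /andP[x0 _].
  apply/esym/cvg_lim => //.
  apply: cvg_EFin; first exact: nearW.
  have h := cvg_zeta1 x0.
  by rewrite expr2; exact: (cvgM h h).
have cvg_int : (\int[lebesgue_measure]_(x in `[0%R, 1%R]) g N x @[N --> \oo] -->
    \int[lebesgue_measure]_(x in `[0%R, 1%R]) limn (g ^~ x))%E.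
  apply: cvg_monotone_convergence.
  - exact: measurable_itv.
  - move=> N; apply/measurable_EFinP.
    by apply: subspace_continuous_measurable_fun =>
        //; exact: continuous_sum_zterm.
  - by move=> N x _; rewrite lee_fin sqr_ge0.
  - move=> x; rewrite /= in_itv/= => /andP[x0 _].
    apply/nondecreasing_seqP => N; rewrite lee_fin big_nat_recr//=.
    have s0 : 0 <= \sum_(0 <= k < N) zterm k x.
      by apply: sumr_ge0 => k _; exact: zterm_ge0.
    rewrite lerXn2r ?nnegrE ?addr_ge0 ?zterm_ge0//.
    by rewrite lerDl zterm_ge0.
apply: (cvg_unique (@ereal_hausdorff R) cvg_int).
rewrite [X in X @ _](_ : _ = (fun N =>
    (p.*2.+1%:R^-1 * (1 - N.+1%:R ^- p.*2.+1) +
  2 * \sum_(0 <= d < N) (itail d.+1%:R p p 1 - itail d.+1%:R p p (N -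
      d)%:R))%:E)); last first.
  by apply/funext => N; exact: integral_sum_zterm_sqr.
apply: cvg_EFin; first exact: nearW.
apply: cvgD.
  rewrite -[X in _ --> X]mulr1; apply: cvgMl_tmp.
  rewrite -[X in _ --> X]subr0; apply: cvgB; first exact: cvg_cst.
  apply: (@squeeze_cvgr _ _ _ _ (cst 0) (@harmonic R)).
  - apply: nearW => N; rewrite invr_ge0 exprn_ge0//= lef_pV2 ?posrE
      ?exprn_gt0//.
    by rewrite -[leLHS]expr1 ler_weXn2l// ler1n.
  - exact: cvg_cst.
  - exact: cvg_harmonic.
apply: cvgMl_tmp; rewrite -[S]subr0.
rewrite (_ : (fun N => _) = (fun N => series (fun d => itail d.+1%:R p p 1) N -
   \sum_(0 <= d < N) itail d.+1%:R p p (N -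
       d)%:R)); first exact: cvgB cvS cvg_itail_tail.
by apply/funext => N; rewrite sumrB.
Qed.

End integral_zeta1_sqr.

(** * Summation over the gap *)

Lemma series_mulrl (R : realType) (c : R) (u : R^nat) :
  series (fun k => c * u k) = (fun N => c * series u N).
Proof. by apply/funext => N; rewrite /series/= mulr_sumr. Qed.

Lemma is_cvg_series_exprN (R : realType) (n : nat) : (2 <= n)%N ->
  cvgn (series (fun d => (d.+2%:R ^- n : R))).
Proof. by move=> n2; apply/cvg_ex; eexists; exact: cvg_series_zeta_sub1. Qed.

(** Nonnegativity of the tail with u squared, written out by one integration by parts, bounds
    [itail1] by a power of 1 / (d + 2). *)
Lemma is_cvg_series_itail1 (R : realType) (q : nat) : (2 <= q)%N ->
  cvgn (series (fun d => itail1 (d.+1%:R : R) q 1)).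
Proof.
case: q => // q q2.
apply: (cvg_series_le _ (@is_cvg_series_exprN R _ q2)) => d.
have d0 : 0 < d.+1%:R :> R by rewrite ltr0n.
rewrite (itail_ge0 0 q.+1 d0 ltr01)/=.
have := itail_ge0 1 q d0 ltr01.
rewrite /= invr1 mulr1 div1r nat1r subr_ge0 => h.
apply: le_trans h; rewrite ler_peMl ?ler1n//.
exact: (itail_ge0 0 q.+1 d0 ltr01).
Qed.

(** Sums over d the negative binomial series at 1 / (d + 2), then exchanges the sums. It evaluates
    the coefficient of psi(1). *)
Lemma cvg_series_bin_zeta (R : realType) (q : nat) : (0 < q)%N ->
  series (fun j => 'C((j + q)%N, q)%:R * (riemann_zeta (q.+1 +
      j)%:R - 1)) @ \oo -->
  riemann_zeta (q.+1%:R : R).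
Proof.
move=> q0.
apply: (@cvg_series_interchange R
  (fun d j => 'C((j + q)%N, q)%:R * d.+2%:R ^- (q.+1 + j))
  (fun d => d.+1%:R ^- q.+1)).
- by move=> d j; rewrite mulr_ge0 ?invr_ge0 ?exprn_ge0.
- move=> d.
  have x01 : 0 <= (d.+2%:R^-1 : R) < 1
      by rewrite invr_ge0 ler0n/= invf_lt1// ltr1n.
  rewrite (_ : series _ = (fun N => d.+2%:R ^- q.+1 *
    series (fun j => 'C((j + q)%N, q)%:R * d.+2%:R^-1 ^+ j) N)); last first.
    apply/funext => N; rewrite /series/= mulr_sumr; apply: eq_bigr => j _.
    by rewrite exprD invfM exprVn; ring.
  rewrite (_ : d.+1%:R ^- q.+1 =
      d.+2%:R ^- q.+1 * (1 - d.+2%:R^-1) ^- q.+1); last first.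
    rewrite -invfM -exprMn; congr ((_ ^+ _)^-1).
    rewrite mulrBr mulr1 mulfV ?pnatr_eq0// -[d.+2%:R]natr1.
    by rewrite addrK.
  by apply: cvgMl_tmp; exact: cvg_series_bin.
- exact: cvg_series_zeta_nat.
- move=> j.
  rewrite (_ : series _ = (fun N => 'C((j + q)%N, q)%:R *
    series (fun d => d.+2%:R ^- (q.+1 + j)) N)); last first.
    exact: series_mulrl.
  by apply: cvgMl_tmp; apply: cvg_series_zeta_sub1; lia.
Qed.

(** Sums the formula for J_d over all gaps d + 1. The logarithms add up to minus the derivative of
    zeta, and each column is a zeta value without its first term. *)
Lemma cvg_series_bin_harmonic_zeta (R : realType) (q : nat) (L : R) :
    (2 <= q)%N ->
  series (fun d => itail1 (d.+1%:R : R) q 1) @ \oo --> L ->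
  series (fun j => 'C((j + q)%N, q)%:R * series harmonic j *
    (riemann_zeta (q.+1 + j)%:R - 1)) @ \oo -->
  L + derive1 (@riemann_zeta R) q.+1%:R
    + series harmonic q * riemann_zeta (q.+1%:R : R).
Proof.
move=> q2 cvL.
have s3 : 3 <= q.+1%:R :> R by rewrite ler_nat.
have cvLn := @cvg_series_ln_zeta R _ s3.
apply: (@cvg_series_interchange R
  (fun d j => 'C((j + q)%N, q)%:R * series harmonic j * d.+2%:R ^- (q.+1 + j))
  (fun d => itail1 (d.+1%:R : R) q 1 - ln d.+1%:R * d.+1%:R `^ (- q.+1%:R) +
     series harmonic q * d.+1%:R ^- q.+1)).
- move=> d j; rewrite !mulr_ge0 ?invr_ge0 ?exprn_ge0//.
  by apply: sumr_ge0 => i _; exact: harmonic_ge0.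
- move=> d.
  have d0 : 0 < d.+1%:R :> R by rewrite ltr0n.
  rewrite (_ : series _ = (fun N => d.+2%:R ^- q.+1 *
    series (fun j => 'C((j + q)%N, q)%:R * series harmonic j * (1 +
        d.+1%:R)^-1 ^+ j) N)); last first.
    apply/funext => N; rewrite /series/= mulr_sumr; apply: eq_bigr => j _.
    by rewrite nat1r exprD invfM exprVn; ring.
  rewrite (_ : itail1 _ _ _ - _ + _ = d.+2%:R ^- q.+1 *
      ((1 + d.+1%:R) ^+ q.+1 *
       (itail1 d.+1%:R q 1 - (ln d.+1%:R -
           series harmonic q) * d.+1%:R ^- q.+1))).
    by apply: cvgMl_tmp; exact: cvg_series_bin_harmonic.
  by rewrite nat1r mulKf ?expf_neq0 ?pnatr_eq0// powR_invn//; ring.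
- rewrite derive1E.
  have [_ ->] := is_derive1_zeta s3.
  rewrite (_ : series _ = (fun N => series (fun d =>
      itail1 (d.+1%:R : R) q 1) N -
    series (fun d => ln d.+1%:R * d.+1%:R `^ (- q.+1%:R)) N +
    series harmonic q * series (fun d => d.+1%:R ^- q.+1) N)); last first.
    apply/funext => N; rewrite {1 2 3 5}/series/= mulr_sumr -sumrB -big_split/=.
    by apply: eq_bigr.
  apply: cvgD; first exact: cvgB.
  by apply: cvgMl_tmp; apply: cvg_series_zeta_nat; exact: ltnW.
- move=> j.
  rewrite (_ : series _ = (fun N => 'C((j + q)%N, q)%:R * series harmonic j *
    series (fun d => d.+2%:R ^- (q.+1 + j)) N)); last first.
    exact: series_mulrl.
  by apply: cvgMl_tmp; apply: cvg_series_zeta_sub1; lia.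
Qed.

(** With n = j + p the quotient of factorials is (2p)! C(j + 2p, 2p) and the argument of psi is j +
    1, so psi splits into psi(1) + H_j. *)
Lemma psi_termE (R : realType) (p j : nat) : psi_term R p.+1 (j + p) =
  ((p.*2)`!)%:R *
  (digamma 1 * ('C((j + p.*2)%N, p.*2)%:R * (riemann_zeta (p.*2.+1 +
      j)%:R - 1)) +
   'C((j + p.*2)%N, p.*2)%:R * series harmonic j * (riemann_zeta (p.*2.+1 +
       j)%:R - 1)).
Proof.
rewrite /psi_term.
rewrite (_ : (j + p + p.+1 - 1)%N = (j + p.*2)%N); last by lia.
rewrite (_ : ((j + p).+1 - p.+1)%N = j); last by lia.
rewrite (_ : (j + p)%N%:R + 2 - p.+1%:R = j.+1%:R :> R); last first.
  by rewrite natrD -!natr1; ring.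
rewrite (_ : (j + p + p.+1)%N = (p.*2.+1 + j)%N); last by lia.
rewrite digamma_nat -(@bin_fact (j + p.*2) p.*2) ?leq_addl// addnK !natrM.
by field; rewrite pnatr_eq0 -lt0n fact_gt0.
Qed.

Lemma cvg_series_psi_term (R : realType) (p : nat) (L : R) : (0 < p)%N ->
  series (fun d => itail1 (d.+1%:R : R) p.*2 1) @ \oo --> L ->
  (fun N : nat => \sum_(p <= n < N) psi_term R p.+1 n) @ \oo -->
  ((p.*2)`!)%:R * (digamma 1 * riemann_zeta (p.*2.+1%:R : R) +
    (L + derive1 (@riemann_zeta R) p.*2.+1%:R
      + series harmonic p.*2 * riemann_zeta (p.*2.+1%:R : R))).
Proof.
move=> p0 cvL.
rewrite -(cvg_shiftn p).
rewrite (_ : (fun n => _) = (fun N => ((p.*2)`!)%:R *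
  (digamma 1 * series (fun j =>
      'C((j + p.*2)%N, p.*2)%:R * (riemann_zeta (p.*2.+1 + j)%:R - 1)) N +
   series (fun j => 'C((j +
       p.*2)%N, p.*2)%:R * series harmonic j * (riemann_zeta (p.*2.+1 +
           j)%:R - 1)) N))); last first.
  apply/funext => N; rewrite -{1}[p]add0n big_addn addnK.
  rewrite {1 2}/series/= [in RHS]mulr_sumr -big_split/= mulr_sumr.
  by apply: eq_bigr => j _; rewrite psi_termE.
apply: cvgMl_tmp; apply: cvgD.
  by apply: cvgMl_tmp; apply: cvg_series_bin_zeta; lia.
by apply: cvg_series_bin_harmonic_zeta => //; lia.
Qed.

(** Sums [fact_itail] at y = 1 over the gaps: the boundary terms are powers of 1 / (d + 2) and add
    up to zeta values minus 1. *)
Lemma cvg_series_itail (R : realType) (p : nat) (L : R) : (0 < p)%N ->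
  series (fun d => itail1 (d.+1%:R : R) p.*2 1) @ \oo --> L ->
  series (fun d => itail (d.+1%:R : R) p p 1) @ \oo -->
  (p`!)%:R ^- 2 *
  (\sum_(0 <= n < p) (-1) ^+ n * ((n + p)`!)%N%:R * ((p - n.+1)`!)%N%:R
     * (riemann_zeta (n + p).+1%:R - 1)
   + (-1) ^+ p * ((p.*2)`!)%:R * L).
Proof.
move=> p0 cvL.
rewrite (_ : series _ = (fun N => (p`!)%:R ^- 2 *
  (\sum_(0 <= n < p) (-1) ^+ n * ((n + p)`!)%N%:R * ((p - n.+1)`!)%N%:R
     * series (fun d => d.+2%:R ^- (n + p).+1) N
   + (-1) ^+ p * ((p.*2)`!)%:R * series (fun d =>
       itail1 (d.+1%:R : R) p.*2 1) N))).
  apply: cvgMl_tmp; apply: cvgD; last exact: cvgMl_tmp.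
  apply: cvg_big => [|n _]; first exact: add_continuous.
  by apply: cvgMl_tmp; apply: cvg_series_zeta_sub1; lia.
apply/funext => N.
have f0 : (p`!)%:R != 0 :> R by rewrite pnatr_eq0 -lt0n fact_gt0.
apply: (mulfI (expf_neq0 2 f0)); rewrite mulVKf ?expf_neq0//.
rewrite /series/= mulr_sumr [X in _ = _ + X]mulr_sumr.
under [X in _ = X + _]eq_bigr do rewrite mulr_sumr.
rewrite exchange_big/= -big_split/=; apply: eq_bigr => d _.
rewrite expr2 fact_itail addnn; congr (_ + _).
by apply: eq_bigr => n _; rewrite expr1n invr1 mul1r nat1r.
Qed.

(** The first conjunct gives the infinite sum its meaning; the equality in the extended reals
    includes finiteness of the integral. *)
Theorem theorem2 (R : realType) (m : nat) (hm : (2 <= m)%N) :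
  cvgn (fun N : nat => \sum_(m.-1 <= n < N) psi_term R m n) /\
  (\int[@lebesgue_measure R]_(x in `[0%R, 1%R]) ((zeta1 m%:R x) ^+ 2)%:E =
   (1 / (2 * m%:R - 1)
    + 2 * (-1) ^+ m / Gamma (m%:R : R) ^+ 2
      * (Gamma (2 * m%:R - 1) * Zfun m%:R
         - \big[+%R/0]_(m.-1 <= n <oo) psi_term R m n)
    + 2 / Gamma (m%:R : R) ^+ 2
      * \sum_(0 <= n < m.-1)
          (-1) ^+ n * ((n + m - 1)`!)%N%:R * ((m - n - 2)`!)%N%:R
          * (riemann_zeta (n + m)%N%:R - 1))%:E)%E.
Proof.
case: m hm => [//|[//|p']] _; set p := p'.+1.
have p0 : (0 < p)%N by [].
(* [L] is the sum of all J_d. It is never evaluated: it enters both the integral and the psi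
   series. *)
have /cvg_ex[L cvL] : cvgn (series (fun d => itail1 (d.+1%:R : R) p.*2 1)).
  by apply: is_cvg_series_itail1; lia.
have cvpsi := cvg_series_psi_term p0 cvL.
split; first by apply/cvg_ex; eexists; exact: cvpsi.
rewrite (integral_zeta1_sqr p0 (cvg_series_itail p0 cvL)); congr (_%:E).
have sE : 2 * p.+1%:R - 1 = p.*2.+1%:R :> R.
  by rewrite -addn1 natrD -[p.*2.+1]addn1 natrD -muln2 natrM; ring.
have -> : \big[+%R/0]_(p.+1.-1 <= n <oo) psi_term R p.+1 n = _ :=
  cvg_lim (@Rhausdorff R) cvpsi.
(* With psi(2m - 1) = psi(1) + H_(2p), the terms in psi(1), H_(2p) and the derivative of zeta cancel
   inside the braces, which reduce to -(2p)! L. *)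
rewrite /Zfun sE !Gamma_nat digamma_nat div1r.
have -> : \sum_(0 <= n < p.+1.-1)
    (-1) ^+ n * ((n + p.+1 - 1)`!)%N%:R * ((p.+1 - n - 2)`!)%N%:R
      * (riemann_zeta (n + p.+1)%N%:R - 1) =
  \sum_(0 <= n < p) (-1) ^+ n * ((n + p)`!)%N%:R * ((p - n.+1)`!)%N%:R
     * (riemann_zeta (n + p).+1%:R - 1) :> R.
  apply: eq_bigr => n _; rewrite addnS subn1/=.
  by rewrite (_ : (p.+1 - n - 2)%N = (p - n.+1)%N)//; lia.
have f0 : (p`!)%:R != 0 :> R by rewrite pnatr_eq0 -lt0n fact_gt0.
rewrite [(-1) ^+ p.+1]exprS; field.
by rewrite f0 nat1r pnatr_eq0.
Qed.
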